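(* Let $\mathscr T=(A,T,G)$ be a regularity structure with a product $\star$, with a model $(\Pi,\Gamma)$ on $\mathbb R^d$ with scaling $\mathfrak s$. Let $V$ be a function-like sector of $\mathscr T$ which is left invariant by $\star$, let $\zeta>0$ be the smallest non-zero value such that $V_\zeta\ne\{0\}$, let $\gamma>0$, and let $F\in\mathcal C^\kappa(\mathbb R^n,\mathbb R)$ for some $\kappa\ge(\gamma/\zeta)\vee1$. Assume furthermore that $V$ is $\gamma$-regular. Then, for any $f=(f_1,\dots,f_n)$ with $f_i\in\mathcal D^\gamma(V)$, the map $\hat F_\gamma(f)$ defined by $$\hat F_\gamma(f)(x)=\mathcal Q_\gamma^-\hat F(f(x))$$ again belongs to $\mathcal D^\gamma(V)$. If one furthermore has $F\in\mathcal C^\kappa(\mathbb R^n,\mathbb R)$ for $\kappa\ge((\gamma/\zeta)\vee1)+1$, then the map $f\mapsto\hat F_\gamma(f)$ is locally Lipschitz continuous in the sense that $$\|\hat F_\gamma(f)-\hat F_\gamma(g)\|_{\gamma;\mathfrak K}\lesssim\|f-g\|_{\gamma;\mathfrak K},\qquad|||\hat F_\gamma(f)-\hat F_\gamma(g)|||_{\gamma;\mathfrak K}\lesssim|||f-g|||_{\gamma;\mathfrak K},$$ for any compact set $\mathfrak K\subset\mathbb R^d$, where the proportionality constant in the first bound is uniform over all $f,g$ with $\|f\|_{\gamma;\mathfrak K}+\|g\|_{\gamma;\mathfrak K}\le C$, while in the second bound it is uniform over all $f,g$ with $|||f|||_{\gamma;\mathfrak K}+|||g|||_{\gamma;\mathfrak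 K}\le C$, for any fixed constant $C$.
   Context: Regularity structure: a triple $\mathscr T=(A,T,G)$ where $A\subset\mathbb R$ contains $0$, is bounded from below and locally finite; $T=\bigoplus_{\alpha\in A}T_\alpha$ with each $T_\alpha$ a Banach space and $T_0\simeq\mathbb R$ with unit vector $\mathbf 1$; $G$ is a group of linear operators on $T$ with $\Gamma\mathbf 1=\mathbf 1$ and $\Gamma a-a\in\bigoplus_{\beta<\alpha}T_\beta$ for all $\Gamma\in G$, $a\in T_\alpha$. $\|a\|_\alpha$ is the norm of the component of $a$ in $T_\alpha$, $T_\gamma^-=\bigoplus_{\beta<\gamma}T_\beta$, and $\mathcal Q_\gamma^-$ is the projection onto $T_\gamma^-$. Scaling: $\mathfrak s$ is a vector of strictly positive relatively prime integers, $|\mathfrak s|=\sum_i\mathfrak s_i$, $\|x-y\|_{\mathfrak s}=\sum_i|x_i-y_i|^{1/\mathfrak s_i}$, $B_{\mathfrak s}(0,1)$ is the corresponding unit ball, and $(\mathcal S^\delta_{\mathfrak s,x}\phi)(y)=\delta^{-|\mathfrak s|}\phi(\delta^{-\mathfrak s_1}(y_1-x_1),\dots,\delta^{-\mathfrak s_d}(y_d-x_d))$. Model $(\Pi,\Gamma)$: a map $\Gamma:\mathbb R^d\times\mathbb R^d\to G$ with $\Gamma_{xx}=1$, $\Gamma_{xy}\Gamma_{yz}=\Gamma_{xz}$, and continuous linear maps $\Pi_x:T\to\mathcal S'(\mathbb R^d)$ with $\Pi_y=\Pi_x\Gamma_{xy}$, such that for every $\gamma>0$ and compact $\mathfrak K$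 there is $C$ with $|(\Pi_xa)(\mathcal S^\delta_{\mathfrak s,x}\phi)|\le C\|a\|\delta^\ell$ and $\|\Gamma_{xy}a\|_m\le C\|a\|\,\|x-y\|_{\mathfrak s}^{\ell-m}$ uniformly over $x,y\in\mathfrak K$, $\delta\in(0,1]$, smooth $\phi$ supported in $B_{\mathfrak s}(0,1)$ with $\|\phi\|_{\mathcal C^{r}}\le1$ ($r$ the smallest integer with $\ell>-r$ for all $\ell\in A$), $\ell\in A$ with $\ell<\gamma$, $m<\ell$, $a\in T_\ell$. Modelled distributions: $\mathcal D^\gamma(V)$ is the space of $f:\mathbb R^d\to T_\gamma^-\cap V$ such that for every compact $\mathfrak K$ $$|||f|||_{\gamma;\mathfrak K}=\|f\|_{\gamma;\mathfrak K}+\sup_{x,y\in\mathfrak K,\ \|x-y\|_{\mathfrak s}\le1}\sup_{\beta<\gamma}\frac{\|f(x)-\Gamma_{xy}f(y)\|_\beta}{\|x-y\|_{\mathfrak s}^{\gamma-\beta}}<\infty,\qquad\|f\|_{\gamma;\mathfrak K}=\sup_{x\in\mathfrak K}\sup_{\beta<\gamma}\|f(x)\|_\beta ,$$ ($\beta\in A$). For vectors $f=(f_1,\dots,f_n)$ norms are summed over components. A function-like sector $V$ (sector of regularity $0$) is a graded subspace $V=\bigoplus_{\beta\ge0}V_\beta$, $V_\beta\subset T_\beta$, with $\Gamma V\subset V$ for all $\Gamma\in G$ and each $V_\beta$ complemented in $T_\beta$. If no such $\zeta$ exists, $\gamma/\zeta$ is read as $0$. Product: a bilinear map $\star$, continuous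 from $T_\alpha\times T_\beta$ to $T_{\alpha+\beta}$, with $\mathbf 1\star a=a\star\mathbf 1=a$; it is assumed associative and commutative. $V$ is $\gamma$-regular if $\Gamma(a\star b)=(\Gamma a)\star(\Gamma b)$ for every $\Gamma\in G$ and all $a\in V_\alpha$, $b\in V_\beta$ with $\alpha+\beta<\gamma$. Lift of $F$: for $a\in V$ write $a=\bar a\mathbf 1+\tilde a$ with $\bar a=\langle\mathbf 1,a\rangle$ the coefficient of $\mathbf 1$ and $\tilde a\in\bigoplus_{\beta>0}T_\beta$. For $a=(a_1,\dots,a_n)\in V^n$, $\hat F(a)=\sum_k\frac{D^kF(\bar a)}{k!}\tilde a^{\star k}$, summed over multiindices $k\in\mathbb N^n$, with $\tilde a^{\star k}=\tilde a_1^{\star k_1}\star\cdots\star\tilde a_n^{\star k_n}$, $\tilde a^{\star0}=\mathbf 1$; only finitely many terms contribute to the projection onto $T_\gamma^-$, and only those are used. $\mathcal C^\kappa$ denotes H\''older spaces with the convention that for integer $\kappa$ the derivatives of order $\kappa-1$ are locally Lipschitz.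
   Formalization: The function-like sector V is required to have V_0 ≠ {0}, so that the unit 1 lies in V; without this the claim fails, e.g. for V = {0}, f = 0 and F(0) ≠ 0, where the lift is F(0)1. *)

(* Defs.v *)
From HB Require Import structures.
From mathcomp Require Import all_boot all_order all_algebra.
From mathcomp Require Import all_classical all_reals all_analysis.
Set Implicit Arguments.
Unset Strict Implicit.
Unset Printing Implicit Defensive.
Import Order.TTheory GRing.Theory Num.Theory.
Import numFieldNormedType.Exports.
Local Open Scope classical_set_scope.
Local Open Scope ring_scope.

Section DirectSum.
Variables (R : realType) (E : R -> completeNormedModType R).

Record dsum := DSum {
  dcomp :> forall a : R, E a;
  dsum_finite : finite_set [set a | dcomp a != 0] }.

HB.instance Definition _ := gen_eqMixin dsum.
HB.instance Definition _ := gen_choiceMixin dsum.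

Lemma dsumP (u v : dsum) : (forall a, u a = v a) -> u = v.
Proof.
case: u v => [u hu] [v hv] /= uv.
have {}uv : u = v by apply: functional_extensionality_dep.
by subst v; congr DSum; exact: Prop_irrelevance.
Qed.

Lemma dsum0_finite : finite_set [set a | (0 : E a) != 0].
Proof. by apply: (sub_finite_set _ (finite_set0 R)) => a /=; rewrite eqxx. Qed.

Lemma dsumD_finite (u v : dsum) : finite_set [set a | u a + v a != 0].
Proof.
apply: (@sub_finite_set _ _ ([set a | u a != 0] `|` [set a | v a != 0])).
  move=> a /= h; case: (eqVneq (u a) 0) => [u0|]; last by left.
  by right; move: h; rewrite u0 add0r.
by rewrite finite_setU; split; exact: dsum_finite.
Qed.

Lemma dsumN_finite (u : dsum) : finite_set [set a | - u a != 0].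
Proof.
by apply: (sub_finite_set _ (dsum_finite u)) => a /=; rewrite oppr_eq0.
Qed.

Lemma dsumZ_finite (c : R) (u : dsum) : finite_set [set a | c *: u a != 0].
Proof.
apply: (sub_finite_set _ (dsum_finite u)) => a /=.
by apply: contra => /eqP ->; rewrite scaler0.
Qed.

Definition dsum_add u v := DSum (dsumD_finite u v).
Definition dsum_opp u := DSum (dsumN_finite u).
Definition dsum_scale c u := DSum (dsumZ_finite c u).

Let addA : associative dsum_add.
Proof. by move=> u v w; apply: dsumP => a /=; rewrite addrA. Qed.
Let addC : commutative dsum_add.
Proof. by move=> u v; apply: dsumP => a /=; rewrite addrC. Qed.
Let add0 : left_id (DSum dsum0_finite) dsum_add.
Proof. by move=> u; apply: dsumP => a /=; rewrite add0r. Qed.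
Let addN : left_inverse (DSum dsum0_finite) dsum_opp dsum_add.
Proof. by move=> u; apply: dsumP => a /=; rewrite addNr. Qed.

HB.instance Definition _ := GRing.isZmodule.Build dsum addA addC add0 addN.

Let scaleA a b u : dsum_scale a (dsum_scale b u) = dsum_scale (a * b) u.
Proof. by apply: dsumP => x /=; rewrite scalerA. Qed.
Let scale1 : left_id 1 dsum_scale.
Proof. by move=> u; apply: dsumP => x /=; rewrite scale1r. Qed.
Let scaleDr : right_distributive dsum_scale +%R.
Proof. by move=> c u v; apply: dsumP => x /=; rewrite scalerDr. Qed.
Let scaleDl u : {morph dsum_scale^~ u : a b / a + b}.
Proof. by move=> a b; apply: dsumP => x /=; rewrite scalerDl. Qed.

HB.instance Definition _ :=
  GRing.Zmodule_isLmodule.Build R dsum scaleA scale1 scaleDr scaleDl.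

Definition dinj_fun (a : R) (x : E a) (b : R) : E b :=
  if pselect (a = b) is left e then eq_rect a (fun c => E c) x b e else 0.

Lemma dinj_finite a (x : E a) : finite_set [set b | dinj_fun x b != 0].
Proof.
apply: (sub_finite_set _ (finite_set1 a)) => b /=.
by rewrite /dinj_fun; case: pselect => [//|_]; rewrite eqxx.
Qed.

Definition dinj a (x : E a) : dsum := DSum (dinj_finite x).

Lemma dtrunc_finite (g : R) (u : dsum) :
  finite_set [set b | (if b < g then u b else 0) != 0].
Proof.
apply: (sub_finite_set _ (dsum_finite u)) => b /=.
by case: ifP => //; rewrite eqxx.
Qed.

Definition dtrunc (g : R) (u : dsum) : dsum := DSum (dtrunc_finite g u).

Definition dlt (g : R) : set dsum := [set u | forall b, g <= b -> u b = 0].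

End DirectSum.

(* The family of spaces is indexed by all of [R], the spaces with index outside
   of [rs_index] being zero; thus T_(a + b) = 0 when a + b is not an index. *)
Record regularity_structure (R : realType) := RegularityStructure {
  rs_index : set R;
  rs_space : R -> completeNormedModType R;
  rs_index0 : rs_index 0;
  rs_index_lbound : has_lbound rs_index;
  rs_index_locally_finite : forall a b : R, finite_set (rs_index `&` `[a, b]);
  rs_space_trivial : forall a, ~ rs_index a -> forall x : rs_space a, x = 0;
  rs_one : rs_space 0;
  rs_one_norm : `|rs_one| = 1;
  rs_one_span : forall x : rs_space 0, exists c : R, x = c *: rs_one;
  rs_group : set {linear (dsum rs_space) -> (dsum rs_space)};
  rs_group1 : rs_group idfun;
  rs_groupM : forall g h, rs_group g -> rs_group h -> rs_group (g \o h);
  rs_groupV : forall g, rs_group g ->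
    exists h, [/\ rs_group h, cancel g h & cancel h g];
  rs_group_one : forall g, rs_group g -> g (dinj rs_one) = dinj rs_one;
  rs_group_lower : forall g, rs_group g -> forall a (x : rs_space a),
    dlt a (g (dinj x) - dinj x) }.

Arguments rs_group {R} _ _.

Notation rs_type S := (dsum (rs_space S)).

Section RegularityStructureTheory.
Variables (R : realType) (S : regularity_structure R).

Definition rs_unit : rs_type S := dinj (rs_one S).

(* <1, u> *)
Definition rs_coef (u : rs_type S) : R := xget 0 [set c | u 0 = c *: rs_one S].

Definition rs_tilde (u : rs_type S) : rs_type S := u - rs_coef u *: rs_unit.

Record product := Product {
  pr_fun :> rs_type S -> rs_type S -> rs_type S;
  pr_linear_l : forall v, linear (pr_fun^~ v);
  pr_linear_r : forall u, linear (pr_fun u);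
  pr_homogeneous : forall a b (x : rs_space S a) (y : rs_space S b) c,
    c != a + b -> pr_fun (dinj x) (dinj y) c = 0;
  pr_continuous : forall a b, continuous
    (fun xy : rs_space S a * rs_space S b =>
       pr_fun (dinj xy.1) (dinj xy.2) (a + b));
  pr_unitl : left_id rs_unit pr_fun;
  pr_unitr : right_id rs_unit pr_fun;
  pr_assoc : associative pr_fun;
  pr_comm : commutative pr_fun }.

Definition linear_subspace (W : lmodType R) (U : set W) :=
  U 0 /\ forall (c : R) u v, U u -> U v -> U (c *: u + v).

Definition complemented (W : completeNormedModType R) (U : set W) :=
  closed U /\ exists U' : set W,
    [/\ linear_subspace U', closed U', U `&` U' = [set 0] &
        forall x, exists u u', [/\ U u, U' u' & x = u + u']].

(* Regularity 0 means that 0 is the lowest degree which occurs, so that [V_0]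
   is nonzero, hence equal to [T_0] and 1 belongs to [V]. The lift of [F] maps
   0 to [F(0) 1], so it could not preserve a sector with [V_0 = 0]. *)
Record function_like_sector := FunctionLikeSector {
  sec_comp : forall b, set (rs_space S b);
  sec_subspace : forall b, linear_subspace (@sec_comp b);
  sec_neg : forall b, b < 0 -> @sec_comp b = [set 0];
  sec_zero : @sec_comp 0 <> [set 0];
  sec_group : forall g, rs_group S g -> forall u : rs_type S,
    (forall b, @sec_comp b (u b)) -> forall b, @sec_comp b (g u b);
  sec_complemented : forall b, complemented (@sec_comp b) }.

Arguments sec_comp : clear implicits.

Definition sector_set (V : function_like_sector) : set (rs_type S) :=
  [set u | forall b, sec_comp V b (u b)].

Definition product_invariant (V : function_like_sector) (star : product) :=
  forall u v, sector_set V u -> sector_set V v -> sector_set V (star u v).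

Definition regular_sector (V : function_like_sector) (star : product) (g : R) :=
  forall h, rs_group S h -> forall a b (x : rs_space S a) (y : rs_space S b),
    sec_comp V a x -> sec_comp V b y -> a + b < g ->
    h (star (dinj x) (dinj y)) = star (h (dinj x)) (h (dinj y)).

Definition is_zeta (V : function_like_sector) (z : R) :=
  [/\ 0 < z, sec_comp V z <> [set 0] &
      forall b, 0 < b -> sec_comp V b <> [set 0] -> z <= b].

Definition zeta_ratio (V : function_like_sector) (g : R) : R :=
  if pselect (exists z, is_zeta V z) is left h then g / projT1 (cid h) else 0.

End RegularityStructureTheory.

Section Derivatives.
Variables (R : realType) (n : nat).
Implicit Types (f : 'rV[R]_n -> R) (k : {ffun 'I_n -> nat}).

Definition partial (i : 'I_n) f : 'rV[R]_n -> R :=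
  fun x => 'D_(delta_mx 0 i) f x.

Definition mdeg k : nat := (\sum_(i < n) k i)%N.

Definition mfact k : nat := (\prod_(i < n) (k i)`!)%N.

Definition partial_multi k f : 'rV[R]_n -> R :=
  foldr (fun i h => iter (k i) (partial i) h) f (enum 'I_n).

Fixpoint Cm (m : nat) f : Prop :=
  continuous f /\
  if m is m'.+1 then
    forall i, (forall x, derivable f x (delta_mx 0 i)) /\ Cm m' (partial i f)
  else True.

Definition smooth f := forall m, Cm m f.

(* For kappa > 0; when kappa is an integer, m = kappa - 1 and the derivatives of
   order m are locally Lipschitz. *)
Definition holder_space (kappa : R) f := exists m : nat,
  [/\ m%:R < kappa, kappa <= m.+1%:R, Cm m f &
    forall k, mdeg k = m -> forall K : set 'rV[R]_n, compact K ->
      exists C : R, forall x y, K x -> K y ->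
        `|partial_multi k f x - partial_multi k f y|
          <= C * `|x - y| `^ (kappa - m%:R)].

Definition weighted_partial (j k : {ffun 'I_n -> nat}) f (x : 'rV[R]_n) : R :=
  (\prod_(i < n) x 0 i ^+ j i) * partial_multi k f x.

Definition schwartz f := smooth f /\
  forall j k, exists C : R, forall x, `|weighted_partial j k f x| <= C.

(* Distributions are functionals on all functions, of which only the values on
   Schwartz functions matter. Continuity is with respect to the seminorms
   sup |x^j D^k f|. *)
Definition tempered_distribution (u : ('rV[R]_n -> R) -> R) :=
  (forall (c : R) f g, schwartz f -> schwartz g ->
     u (fun x => c * f x + g x) = c * u f + u g) /\
  exists (C : R) (N : nat), forall f, schwartz f -> forall M : R,
    (forall j k, (mdeg j <= N)%N -> (mdeg k <= N)%N -> forall x,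
       `|weighted_partial j k f x| <= M) ->
    `|u f| <= C * M.

End Derivatives.

Record scaling (d : nat) := Scaling {
  sc_fun :> 'I_d -> nat;
  sc_gt0 : forall i, (0 < sc_fun i)%N;
  sc_coprime : (\big[gcdn/0]_(i < d) sc_fun i = 1)%N }.

Section Scaling.
Variables (R : realType) (d : nat) (s : scaling d).

Definition sc_size : nat := (\sum_(i < d) s i)%N.

Definition sc_norm (x : 'rV[R]_d) : R :=
  \sum_(i < d) `|x 0 i| `^ (s i)%:R^-1.

Definition sc_test (delta : R) (x : 'rV[R]_d) (phi : 'rV[R]_d -> R) :
    'rV[R]_d -> R :=
  fun y => delta ^- sc_size *
    phi (\row_(i < d) (delta ^- s i * (y 0 i - x 0 i))).

Definition test_function (r : nat) (phi : 'rV[R]_d -> R) :=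
  [/\ smooth phi,
      closure [set x | phi x != 0] `<=` [set x | sc_norm x < 1] &
      forall k x, (mdeg k <= r)%N -> `|partial_multi k phi x| <= 1].

End Scaling.

(* As 0 is an index, r is positive, so nothing is lost by taking it in nat. *)
Definition test_order (R : realType) (S : regularity_structure R) (r : nat) :=
  (forall l, rs_index S l -> - r%:R < l) /\
  forall r' : nat, (forall l, rs_index S l -> - r'%:R < l) -> (r <= r')%N.

(* Continuity of Pi_x is for the weak-* topology on distributions, which for
   linear maps on a Banach space is the same as for the strong topology. *)
Record model (R : realType) (S : regularity_structure R) (d : nat)
    (s : scaling d) := Model {
  mod_Gamma : 'rV[R]_d -> 'rV[R]_d -> {linear (rs_type S) -> (rs_type S)};
  mod_Pi : 'rV[R]_d -> rs_type S -> ('rV[R]_d -> R) -> R;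
  mod_Gamma_group : forall x y, rs_group S (mod_Gamma x y);
  mod_Gamma_id : forall x u, mod_Gamma x x u = u;
  mod_Gamma_comp : forall x y z u,
    mod_Gamma x y (mod_Gamma y z u) = mod_Gamma x z u;
  mod_Pi_distribution : forall x u, tempered_distribution (mod_Pi x u);
  mod_Pi_linear : forall x phi, schwartz phi ->
    forall (c : R) u v,
      mod_Pi x (c *: u + v) phi = c * mod_Pi x u phi + mod_Pi x v phi;
  mod_Pi_continuous : forall x phi, schwartz phi ->
    forall a, continuous (fun u : rs_space S a => mod_Pi x (dinj u) phi);
  mod_Pi_Gamma : forall x y u phi, schwartz phi ->
    mod_Pi y u phi = mod_Pi x (mod_Gamma x y u) phi;
  mod_bounds : forall (g : R) (K : set 'rV[R]_d) (r : nat),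
    0 < g -> compact K -> test_order S r ->
    exists C : R, forall l (u : rs_space S l), rs_index S l -> l < g ->
      (forall x delta phi, K x -> 0 < delta <= 1 -> test_function s r phi ->
         `|mod_Pi x (dinj u) (sc_test s delta x phi)|
           <= C * `|u| * delta `^ l) /\
      (forall x y m, K x -> K y -> m < l ->
         `|mod_Gamma x y (dinj u) m|
           <= C * `|u| * sc_norm s (x - y) `^ (l - m)) }.

Section ModelledDistributions.
Variables (R : realType) (S : regularity_structure R) (d : nat).
Variables (s : scaling d) (M : model S s).
Implicit Types (K : set 'rV[R]_d) (f : 'rV[R]_d -> rs_type S).

Definition esup0 (X : set (\bar R)) : \bar R := ereal_sup (0%E |` X).

(* ||f||_{g;K} *)
Definition md_norm0 (g : R) K f : \bar R :=
  esup0 [set e | exists x b,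
    [/\ K x, rs_index S b, b < g & e = `|f x b|%:E]].

(* the quotient is 0 / 0 = 0 for x = y *)
Definition md_seminorm (g : R) K f : \bar R :=
  esup0 [set e | exists x y b,
    [/\ K x, K y, sc_norm s (x - y) <= 1, rs_index S b /\ b < g &
        e = (`|(f x - mod_Gamma M x y (f y)) b|
               / sc_norm s (x - y) `^ (g - b))%:E]].

(* |||f|||_{g;K} *)
Definition md_norm (g : R) K f : \bar R :=
  (md_norm0 g K f + md_seminorm g K f)%E.

Definition modelled (V : function_like_sector S) (g : R) f :=
  (forall x, dlt g (f x) /\ sector_set V (f x)) /\
  forall K, compact K -> (md_norm g K f < +oo)%E.

Section Vectors.
Variable n : nat.
Implicit Types F : 'I_n -> 'rV[R]_d -> rs_type S.

Definition md_norm0_vec (g : R) K F : \bar R :=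
  (\sum_(i < n) md_norm0 g K (F i))%E.

Definition md_norm_vec (g : R) K F : \bar R :=
  (\sum_(i < n) md_norm g K (F i))%E.

End Vectors.
End ModelledDistributions.

Section Lift.
Variables (R : realType) (S : regularity_structure R) (star : product S).
Variables (n : nat) (F : 'rV[R]_n -> R).

Definition star_pow (u : 'I_n -> rs_type S) (k : {ffun 'I_n -> nat}) :
    rs_type S :=
  \big[star/rs_unit S]_(i < n) iter (k i) (star (u i)) (rs_unit S).

Definition Fhat_term (u : 'I_n -> rs_type S) (k : {ffun 'I_n -> nat}) :
    rs_type S :=
  (partial_multi k F (\row_(i < n) rs_coef (u i)) / (mfact k)%:R)
    *: star_pow (fun i => rs_tilde (u i)) k.

(* The truncated lift at a point, Q_g^- (F^(u)), where F^(u) is the formal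
   series of the [Fhat_term u k]: the sum is over the indices k whose truncated
   term is nonzero. If the u i are in a function-like sector, these are finitely
   many, as the terms of order k have no component of degree below
   zeta * mdeg k. *)
Definition Fhat_trunc (g : R) (u : 'I_n -> rs_type S) : rs_type S :=
  \sum_(k \in [set: {ffun 'I_n -> nat}]) dtrunc g (Fhat_term u k).

Definition Fhat (d : nat) (g : R) (f : 'I_n -> 'rV[R]_d -> rs_type S) :
    'rV[R]_d -> rs_type S :=
  fun x => Fhat_trunc g (fun i => f i x).

End Lift.

(* Main.v *)
Require Import Defs.
From HB Require Import structures.
From mathcomp Require Import all_boot all_order all_algebra.
From mathcomp Require Import all_classical all_reals all_analysis.
From mathcomp Require Import ring lra.
Set Implicit Arguments.
Unset Strict Implicit.
Unset Printing Implicit Defensive.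
Import Order.TTheory GRing.Theory Num.Theory.
Import numFieldNormedType.Exports.
Local Open Scope classical_set_scope.
Local Open Scope ring_scope.

(* Fix [x, y], let [delta] be their distance, and say that an element has order
   [p] if its component of degree [a] is [O(delta^(p - a))] for all
   [a < gamma]. Orders add up under the product, [Gamma_xy] maps a homogeneous
   element of degree [a] to an element of order [a], and the bound to be proved
   says that [h(x) - Gamma_xy h(y)] has order [gamma], for [h] the lift of [f].
   Write [f(x) = f0(x) 1 + f'(x)] and [c = f0(x) - f0(y)]. Modulo order [gamma],
   [Gamma_xy] is multiplicative (regularity of the sector) and maps [f'(y)] to
   [f'(x) + c 1]. The binomial formula then turns [Gamma_xy h(y)] into
   [h(x)] minus the sum over [l] of [f'(x)^l / l!] times the remainder of the
   Taylor formula of [D^l F] from [f0(y)] to [f0(x)]. With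
   [z = min(zeta, gamma)], the first factor has order [z |l|], and the remainder
   is [O(|c|^(kappa - |l|))] with [c = O(delta^z)] and [z kappa >= gamma].

   For the Lipschitz bounds all quantities come in pairs, one built from [f] and
   one from [g], and the definition of order also asks that the difference
   within a pair carry an additional factor [eps], the distance of [f] and [g].
   This is again stable under all the operations used; only the Taylor
   remainders need one more derivative of [F]. The first part of the theorem is
   the case [f = g], [eps = 0], and the bounds on [||.||] are those for
   [delta = 1]. *)

(** * Partial derivatives along coordinate axes *)

(** Every constant has to be uniform over the points of the compact set and, for the Lipschitz
    bounds, over all pairs of modelled distributions of bounded norm. For this reason all elements
    come in families over an arbitrary index type [J], and [of_order] chooses its constant before
    the index. In the end [J] consists of all admissible pairs together with all admissible points,
    so one application of the calculus gives the uniform bound.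

    The calculus can ignore degrees from [gamma] on because a function-like sector has no negative
    degrees: a factor of degree at least [gamma] cannot contribute to a component of a product below
    [gamma].

    Write kappa = m + theta with 0 < theta <= 1. Terms of the lift with |k| > m have degree at least
    z (m + 1) >= gamma, so the truncated lift is a sum over |k| <= m, with the same m as in the
    Taylor formulas. For the Lipschitz bounds kappa' is split as (m + 1) + theta, still with gamma
    <= z (m + theta); the derivative left over pays for the differences. Taking the minimum with
    gamma in z makes an error of order gamma also one of order z, as the estimate of c requires. *)

Section RowNorm.
Variables (R : realType) (n : nat).
Implicit Types x y : 'rV[R]_n.

Lemma row_norm_coord x i : `|x 0 i| <= `|x|.
Proof.
rewrite [leRHS]/Num.norm /= mx_normrE; apply/bigmax_geP; right => /=.
by exists (0, i).
Qed.

Lemma row_norm_le x r : 0 <= r -> (forall i, `|x 0 i| <= r) -> `|x| <= r.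
Proof.
move=> r0 h; rewrite [leLHS]/Num.norm /= mx_normrE; apply/bigmax_leP; split => //.
by case=> a b _ /=; rewrite (ord1 a).
Qed.

Lemma row_norm_delta i : `|delta_mx 0 i : 'rV[R]_n| <= 1.
Proof.
apply: row_norm_le => // j; rewrite mxE /=.
by case: eqP => _; rewrite ?normr1 ?normr0 ?ler01.
Qed.

End RowNorm.

Section AxisCalculus.
Variables (R : realType) (n : nat).
Implicit Types (f : 'rV[R]_n -> R) (x y : 'rV[R]_n).

Local Notation e i := (delta_mx 0 i : 'rV[R]_n).

Lemma is_derive_axis f x (v : 'rV[R]_n) (t : R) : derivable f (x + t *: v) v ->
  is_derive t 1 (fun s => f (x + s *: v)) ('D_v f (x + t *: v)).
Proof.
have E : (fun h : R => h^-1 *: (((fun s => f (x + s *: v)) \o shift t) (h *: 1)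
           - f (x + t *: v)))
       = (fun h : R => h^-1 *: ((f \o shift (x + t *: v)) (h *: v)
           - f (x + t *: v))).
  apply/funext => h /=; congr (_ *: (f _ - _)).
  by rewrite [h *: 1]mulr1 scalerDl addrCA.
by move=> df; split; rewrite /derivable /derive E.
Qed.

(** The intermediate point is given as a fraction [c] of the step, so that one statement serves both
    signs of [h]. *)
Lemma mvt_axis f x (i : 'I_n) (h : R) :
  (forall t : R, derivable f (x + t *: e i) (e i)) ->
  exists2 c : R, 0 <= c <= 1 &
    f (x + h *: e i) - f x = partial i f (x + (c * h) *: e i) * h.
Proof.
move=> df; pose phi s := f (x + s *: e i).
have dphi (t : R) : is_derive t 1 phi (partial i f (x + t *: e i)).
  exact: is_derive_axis.
have cphi (A : set R) : {within A, continuous phi}.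
  apply: continuous_subspaceT => t; apply: differentiable_continuous.
  by apply/derivable1_diffP; have [] := dphi t.
have -> : f x = phi 0 by rewrite /phi scale0r addr0.
rewrite -/(phi h); have [h0|h0|<-] := ltgtP 0 h; last first.
- by exists 0; [rewrite lexx ler01|rewrite subrr mulr0].
- have [c] := @MVT_segment _ phi _ _ _ (ltW h0) (fun t _ => dphi t) (cphi _).
  rewrite in_itv /= => /andP[hc c0] /eqP; rewrite sub0r mulrN.
  rewrite -eqr_oppLR opprB => /eqP ->; exists (c / h).
    by rewrite -mulrNN -invrN divr_ge0 ?ler_pdivrMr ?oppr_gt0 ?oppr_ge0 ?mul1r
      ?lerN2 ?hc ?(ltW h0).
  by rewrite divfK// lt_eqF.
- have [c] := @MVT_segment _ phi _ _ _ (ltW h0) (fun t _ => dphi t) (cphi _).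
  rewrite in_itv /= => /andP[c0 ch] ->; rewrite subr0; exists (c / h).
    by rewrite divr_ge0 ?ler_pdivrMr ?mul1r ?ch ?c0 ?(ltW h0).
  by rewrite divfK// gt_eqF.
Qed.

(** The coordinates of [y] are replaced by those of [x] one at a time ([g k] has the first [k]
    replaced), with the mean value theorem on each axis. The path stays in the ball because the norm
    is the maximum norm, whose balls are boxes. *)
Lemma lipschitz_ball_partial f (r L : R) :
  (forall w i, derivable f w (e i)) ->
  (forall w i, `|w| <= r -> `|partial i f w| <= L) ->
  forall x y, `|x| <= r -> `|y| <= r -> `|f x - f y| <= L * n%:R * `|x - y|.
Proof.
move=> df bf x y xr yr.
pose g (k : nat) : 'rV[R]_n := \row_i (if (i < k)%N then x 0 i else y 0 i).
suff H k : (k <= n)%N -> `|f (g k) - f (g 0%N)| <= L * k%:R * `|x - y|.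
  have gn : g n = x by apply/rowP => i; rewrite mxE ltn_ord.
  have g0 : g 0%N = y by apply/rowP => i; rewrite mxE.
  by have := H n (leqnn n); rewrite gn g0.
elim: k => [_|k IH kn]; first by rewrite subrr normr0 mulr0 mul0r.
pose i := Ordinal kn.
have gS : g k.+1 = g k + (x 0 i - y 0 i) *: e i.
  apply/rowP => j; rewrite !mxE /= ltnS leq_eqVlt.
  have [->|ji] := eqVneq j i; first by rewrite /= eqxx /= ltnn mulr1 addrCA subrr addr0.
  have -> : (nat_of_ord j == k) = false.
    by apply/negbTE; apply: contraNneq ji => jk; apply/eqP/val_inj.
  by rewrite mulr0 addr0.
have [c /andP[c0 c1] E] := @mvt_axis f (g k) i (x 0 i - y 0 i) (fun t => df _ _).
have r0 : 0 <= r by apply: le_trans xr.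
have cb : `|g k + (c * (x 0 i - y 0 i)) *: e i| <= r.
  apply: row_norm_le => // j; rewrite !mxE /=.
  have [->|ji] := eqVneq j i; last first.
    rewrite mulr0 addr0.
    case: ifP => _; [apply: le_trans xr|apply: le_trans yr]; exact: row_norm_coord.
  rewrite /= ltnn mulr1 ler_norml.
  have := le_trans (row_norm_coord x i) xr; rewrite ler_norml => /andP[xr1 xr2].
  have := le_trans (row_norm_coord y i) yr; rewrite ler_norml => /andP[yr1 yr2].
  by apply/andP; split; nra.
rewrite -(subrK (f (g k)) (f (g k.+1))) -addrA.
apply: (le_trans (ler_normD _ _)).
rewrite -natr1 mulrDr mulr1 mulrDl [leRHS]addrC lerD ?IH ?(ltnW kn)//.
rewrite gS E normrM ler_pM// ?bf//.
by have := row_norm_coord (x - y) i; rewrite !mxE. 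
Qed.

(** The second difference [D k l h] is symmetric in [k] and [l], and two uses of the mean value
    theorem write it as h^2 times a mixed derivative near [p]. Continuity of both mixed derivatives
    at [p] then makes them agree there. *)
Lemma partialC f (i j : 'I_n) : Cm 2 f -> partial i (partial j f) = partial j (partial i f).
Proof.
move=> [_ C2]; apply/funext => p.
have dF k x : derivable f x (e k) by have [] := C2 k.
have dp k l x : derivable (partial k f) x (e l).
  by have [_ [_ /(_ l)[]]] := C2 k.
have cp k l : continuous (partial l (partial k f)).
  by have [_ [_ /(_ l)[_ []]]] := C2 k.
pose D k l (h : R) := f (p + h *: e k + h *: e l) - f (p + h *: e k)
  - (f (p + h *: e l) - f p).
have DC k l h : D k l h = D l k h by rewrite /D (addrAC p); ring.
have mixed k l (h : R) : 0 < h -> exists2 w, `|w - p| <= h + h &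
    D k l h = partial l (partial k f) w * h * h.
  move=> h0; pose u x := f (x + h *: e l) - f x.
  have du x : is_derive x (e k) u (partial k f (x + h *: e l) - partial k f x).
    apply: is_deriveB; last exact/derivableP.
    have E : (fun t : R => t^-1 *: (((fun x => f (x + h *: e l)) \o shift x) (t *: e k)
           - f (x + h *: e l)))
       = (fun t : R => t^-1 *: ((f \o shift (x + h *: e l)) (t *: e k)
           - f (x + h *: e l))).
      by apply/funext => t /=; rewrite addrA.
    have := dF k (x + h *: e l).
    by split; rewrite /partial /derivable /derive E.
  have [c /andP[c0 c1] Ec] := @mvt_axis u p k h (fun t => @ex_derive _ _ _ _ _ _ _ (du _)).
  have [c' /andP[c'0 c'1] Ec'] := @mvt_axis (partial k f) (p + (c * h) *: e k) l h (fun t => dp _ _ _).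
  exists (p + (c * h) *: e k + (c' * h) *: e l).
    rewrite -(addrA p) addrAC subrr add0r; apply: (le_trans (ler_normD _ _)).
    rewrite !normrZ; apply: lerD;
      rewrite ?normrM !(@ger0_norm R)// ?(ltW h0)// -[leRHS]mulr1 ler_pM
        ?row_norm_delta ?mulr_ge0 ?(ltW h0)//;
      by rewrite -[leRHS]mul1r ler_pM ?(ltW h0).
  rewrite -Ec' /D -/(u _) -/(u _) Ec; congr (_ * _).
  by rewrite /partial; exact: derive_val.
apply/eqP; rewrite -subr_eq0 -normr_le0; apply/ler_addgt0Pl => eps eps0.
rewrite addr0.
have e2 : 0 < eps / 2 by rewrite divr_gt0.
have /cvgrPdist_le/(_ _ e2) := cp j i p => /nbhs_ballP[r1 /= r10 B1].
have /cvgrPdist_le/(_ _ e2) := cp i j p => /nbhs_ballP[r2 /= r20 B2].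
(* The intermediate points are within [h + h] of [p], so this keeps them in both balls. *)
pose h := Num.min r1 r2 / 4.
have m0 : 0 < Num.min r1 r2 by rewrite lt_min r10 r20.
have h0 : 0 < h by rewrite divr_gt0.
have hr : h + h < Num.min r1 r2 by rewrite /h; lra.
have [hr1 hr2] : h + h < r1 /\ h + h < r2 by move: hr; rewrite lt_min => /andP[].
have [w1 w1p E1] := mixed j i h h0.
have [w2 w2p E2] := mixed i j h h0.
have E : partial i (partial j f) w1 = partial j (partial i f) w2.
  have hn : h != 0 by rewrite gt_eqF.
  by move: E1; rewrite DC E2 => /(mulIf hn)/(mulIf hn)/esym.
have b1 : `|partial i (partial j f) p - partial i (partial j f) w1| <= eps / 2.
  by apply: B1; rewrite /= -ball_normE /ball_ /= distrC (le_lt_trans w1p).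
have b2 : `|partial j (partial i f) p - partial j (partial i f) w2| <= eps / 2.
  by apply: B2; rewrite /= -ball_normE /ball_ /= distrC (le_lt_trans w2p).
rewrite -E in b2.
move: b1 b2; move: (partial i (partial j f) p) => a; move: (partial j (partial i f) p) => b.
move: (partial i (partial j f) w1) => c b1 b2; clear -b1 b2.
rewrite (splitr eps) (le_trans (ler_distD c a b))// (lerD b1)//.
by rewrite distrC.
Qed.

End AxisCalculus.

(** * Multi-indices and iterated partial derivatives *)

Section MultiIndex.
Variable n : nat.
Implicit Types (k l j : {ffun 'I_n -> nat}) (i : 'I_n).

Definition madd k l : {ffun 'I_n -> nat} := [ffun i => (k i + l i)%N].
Definition munit i : {ffun 'I_n -> nat} := [ffun j => nat_of_bool (j == i)].
Definition mnil : {ffun 'I_n -> nat} := [ffun=> 0%N].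
Definition mle k l := [forall i, (k i <= l i)%N].
Definition msub k l : {ffun 'I_n -> nat} := [ffun i => (k i - l i)%N].

Lemma mleP k l : reflect (forall i, (k i <= l i)%N) (mle k l).
Proof. exact: forallP. Qed.

Lemma maddC k l : madd k l = madd l k.
Proof. by apply/ffunP => i; rewrite !ffunE addnC. Qed.

Lemma madd_inj l : injective (madd l).
Proof.
by move=> j k /ffunP jk; apply/ffunP => i; move: (jk i); rewrite !ffunE => /addnI.
Qed.

Lemma maddK l k : mle l k -> madd l (msub k l) = k.
Proof. by move/mleP => lk; apply/ffunP => i; rewrite !ffunE subnKC. Qed.

Lemma msub_madd l j : msub (madd l j) l = j.
Proof. by apply/ffunP => i; rewrite !ffunE addKn. Qed.

Lemma mle_madd l j : mle l (madd l j).
Proof. by apply/mleP => i; rewrite ffunE leq_addr. Qed.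

Lemma mdegD k l : mdeg (madd k l) = (mdeg k + mdeg l)%N.
Proof. by rewrite /mdeg -big_split; apply: eq_bigr => i _; rewrite ffunE. Qed.

Lemma mdeg_unit i : mdeg (munit i) = 1%N.
Proof.
rewrite /mdeg (bigD1 i)//= ffunE eqxx big1// => j /negbTE ji.
by rewrite ffunE ji.
Qed.

Lemma mdeg_zero : mdeg mnil = 0%N.
Proof. by rewrite /mdeg big1// => i _; rewrite ffunE. Qed.

Lemma mdeg_eq0 k : mdeg k = 0%N -> k = mnil.
Proof.
move/eqP; rewrite sum_nat_eq0 => /forallP k0; apply/ffunP => i.
by rewrite ffunE; apply/eqP; exact: (k0 i).
Qed.

Lemma mdeg_le k l : mle k l -> (mdeg k <= mdeg l)%N.
Proof. by move/mleP => kl; apply: leq_sum. Qed.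

Lemma mle_unit i k : mle (munit i) k = (0 < k i)%N.
Proof.
apply/mleP/idP => [/(_ i)|ki j]; first by rewrite ffunE eqxx.
by rewrite ffunE; case: eqP => // ->.
Qed.

(** The entries of an index of degree at most [m] are at most [m], so the indices can be enumerated
    through the finite type of functions into ['I_m.+1]. *)
Definition midx (m : nat) : seq {ffun 'I_n -> nat} :=
  [seq [ffun i => nat_of_ord (h i)] | h : {ffun 'I_n -> 'I_m.+1} <-
     [seq h : {ffun 'I_n -> 'I_m.+1} <- enum {ffun 'I_n -> 'I_m.+1} | (\sum_i h i <= m)%N]].

Lemma mem_midx m k : (k \in midx m) = (mdeg k <= m)%N.
Proof.
apply/mapP/idP => [[h]|km].
  rewrite mem_filter => /andP[hm _] ->; rewrite /mdeg.
  by rewrite (eq_bigr (fun i => nat_of_ord (h i)))// => i _; rewrite ffunE.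
have ki i : (k i < m.+1)%N.
  by rewrite ltnS; apply: leq_trans km; rewrite /mdeg (bigD1 i)//= leq_addr.
exists [ffun i => Ordinal (ki i)]; last by apply/ffunP => i; rewrite !ffunE.
rewrite mem_filter mem_enum andbT; apply: leq_trans km.
by rewrite /mdeg; apply: leq_sum => i _; rewrite ffunE.
Qed.

Lemma midx_uniq m : uniq (midx m).
Proof.
rewrite map_inj_uniq => [|h h' /ffunP hh].
  exact: (filter_uniq _ (enum_uniq _)).
by apply/ffunP => i; apply: val_inj; have := hh i; rewrite !ffunE.
Qed.

Lemma midx_shift l m : perm_eq [seq k <- midx (mdeg l + m) | mle l k]
  [seq madd l j | j <- midx m].
Proof.
apply: uniq_perm => [||k]; first by rewrite filter_uniq ?midx_uniq.
  by rewrite map_inj_uniq ?midx_uniq//; apply: madd_inj.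
rewrite mem_filter mem_midx; apply/andP/mapP => [[lk km]|[j]].
  exists (msub k l); last by rewrite maddK.
  by rewrite mem_midx -(leq_add2l (mdeg l)) -mdegD maddK.
by rewrite mem_midx => jm ->; rewrite mle_madd mdegD leq_add2l.
Qed.

Lemma midx0 : midx 0 = [:: mnil].
Proof.
apply: perm_small_eq => //; apply: uniq_perm => [||k]; rewrite ?midx_uniq//.
by rewrite mem_midx leqn0 inE; apply/eqP/eqP => [/mdeg_eq0|->]; rewrite ?mdeg_zero.
Qed.

Lemma big_midx_shift (V : nmodType) l m (G : {ffun 'I_n -> nat} -> V) :
  \sum_(k <- midx (mdeg l + m) | mle l k) G k
    = \sum_(j <- midx m) G (madd l j).
Proof. by rewrite -big_filter (perm_big _ (midx_shift l m)) big_map. Qed.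

(** [partial_multi] applies derivatives in a fixed order of the coordinates. As words, rearranging
    derivatives becomes permuting letters, and adding multi-indices becomes concatenation up to
    permutation. *)
Definition mword k : seq 'I_n := flatten [seq nseq (k i) i | i <- enum 'I_n].

Lemma count_mword k i : count_mem i (mword k) = k i.
Proof.
rewrite /mword count_flatten -map_comp sumnE big_map big_enum /=.
rewrite (bigD1 i)//= big1 ?addn0; last first.
  by move=> j /negbTE ji; rewrite count_nseq /= ji mul0n.
by rewrite count_nseq /= eqxx mul1n.
Qed.

Lemma size_mword k : size (mword k) = mdeg k.
Proof.
rewrite /mword size_flatten /shape -map_comp sumnE big_map big_enum /=.
by apply: eq_bigr => i _; rewrite size_nseq.
Qed.

Lemma mwordD k l : perm_eq (mword (madd k l)) (mword k ++ mword l).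
Proof.
by apply/allP => i _ /=; rewrite count_cat !count_mword ffunE.
Qed.

Lemma mword_unit i : perm_eq (mword (munit i)) [:: i].
Proof.
by apply/allP => j _ /=; rewrite count_mword ffunE addn0 [j == i]eq_sym.
Qed.

End MultiIndex.

Section IteratedPartials.
Variables (R : realType) (n : nat).
Implicit Types (f : 'rV[R]_n -> R) (w : seq 'I_n) (k l j : {ffun 'I_n -> nat}).

Definition partial_word w f := foldr (@partial R n) f w.

Lemma partial_multi_word k f : partial_multi k f = partial_word (mword k) f.
Proof.
rewrite /partial_multi /partial_word /mword; elim: (enum 'I_n) => //= i s ->.
by rewrite foldr_cat; elim: (k i) => //= p ->.
Qed.

Lemma Cm_le m m' f : (m <= m')%N -> Cm m' f -> Cm m f.
Proof.
elim: m m' f => [|m IH] [|m'] f //= mm [cf H]; split => // i.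
by have [df Ci] := H i; split => //; apply: IH _ Ci.
Qed.

Lemma Cm_partial m f i : Cm m.+1 f -> Cm m (partial i f).
Proof. by move=> [_ /(_ i)[]]. Qed.

Lemma Cm_derivable m f i x : Cm m.+1 f -> derivable f x (delta_mx 0 i).
Proof. by move=> [_ /(_ i)[]]. Qed.

Lemma Cm_continuous m f : Cm m f -> continuous f.
Proof. by case: m => [|m] []. Qed.

Lemma Cm_word m w f : Cm (size w + m) f -> Cm m (partial_word w f).
Proof.
elim: w m => [|i w IH] m //= Cf; apply: Cm_partial; apply: IH.
by rewrite addnS.
Qed.

Lemma partial_word_comm w f i : Cm (size w).+1 f ->
  partial i (partial_word w f) = partial_word w (partial i f).
Proof.
elim: w => [//|j w IH] Cf; rewrite [partial_word _ _]/= partialC; last first.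
  by apply: Cm_word; rewrite addn2.
by rewrite IH//; apply: (Cm_le _ Cf).
Qed.

Lemma partial_word_perm w w' f : Cm (size w) f -> perm_eq w w' ->
  partial_word w f = partial_word w' f.
Proof.
elim: w w' f => [|i w IH] w' f Cf pw.
  by move: pw; rewrite perm_sym => /perm_nilP ->.
have: i \in w' by rewrite -(perm_mem pw) mem_head.
move=> iw; case/splitPr: iw pw => w1 w2 pw.
have pw' : perm_eq w (w1 ++ w2).
  by move: pw; rewrite perm_sym perm_catC /= perm_cons perm_catC perm_sym.
have sw : size w = (size w1 + size w2)%N by rewrite (perm_size pw') size_cat.
rewrite /= (IH (w1 ++ w2))//; last exact: (Cm_le _ Cf).
rewrite /partial_word !foldr_cat /= -/(partial_word _ _) partial_word_comm//.
by apply: Cm_word; rewrite addnS addnC -sw.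
Qed.

Lemma partial_multiD k l f : Cm (mdeg k + mdeg l) f ->
  partial_multi (madd k l) f = partial_multi k (partial_multi l f).
Proof.
move=> Cf; rewrite !partial_multi_word (partial_word_perm _ (mwordD k l)).
  by rewrite /partial_word foldr_cat.
by rewrite size_mword mdegD.
Qed.

Lemma partial_multi_unit i f : Cm 1 f -> partial_multi (munit i) f = partial i f.
Proof.
move=> Cf; rewrite !partial_multi_word (partial_word_perm _ (mword_unit i))//.
by rewrite size_mword mdeg_unit.
Qed.

Lemma partial_multi0 f : partial_multi (mnil n) f = f.
Proof.
rewrite partial_multi_word.
by have /size0nil-> : size (mword (mnil n)) = 0%N by rewrite size_mword mdeg_zero.
Qed.

Lemma Cm_multi m k f : Cm (mdeg k + m) f -> Cm m (partial_multi k f).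
Proof. by rewrite partial_multi_word -size_mword; apply: Cm_word. Qed.

Lemma partial_multi_comm k f i : Cm (mdeg k).+1 f ->
  partial i (partial_multi k f) = partial_multi k (partial i f).
Proof.
by move=> Cf; rewrite !partial_multi_word partial_word_comm// size_mword.
Qed.

Lemma partial_multi_munit k f i : Cm (mdeg k).+1 f ->
  partial_multi (madd (munit i) k) f = partial_multi k (partial i f).
Proof.
move=> Cf; rewrite maddC partial_multiD; last by rewrite mdeg_unit addn1.
by rewrite partial_multi_unit//; exact: (Cm_le _ Cf).
Qed.

End IteratedPartials.

(** * Taylor remainders *)

Section TaylorRemainder.
Variables (R : realType) (n : nat).
Implicit Types (f : 'rV[R]_n -> R) (b c x : 'rV[R]_n).
Implicit Types (k l j : {ffun 'I_n -> nat}) (i : 'I_n).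

Local Notation e i := (delta_mx 0 i : 'rV[R]_n).

Lemma is_derive_from_axis f x (v : 'rV[R]_n) d :
  is_derive (0 : R) 1 (fun t => f (x + t *: v)) d -> is_derive x v f d.
Proof.
have E : (fun h : R => h^-1 *: (((fun s => f (x + s *: v)) \o shift (0 : R)) (h *: 1)
           - f (x + (0 : R) *: v)))
       = (fun h : R => h^-1 *: ((f \o shift x) (h *: v) - f x)).
  apply/funext => h /=.
  by rewrite scale0r !addr0 [h *: 1]mulr1 [x + _]addrC.
by case; rewrite /derivable /derive E => *; split.
Qed.

Lemma is_derive_bigsum (V : normedModType R) (I : Type) (r : seq I)
    (g dg : I -> V -> R) (x v : V) :
  (forall p, is_derive x v (g p) (dg p x)) ->
  is_derive x v (fun y => \sum_(k <- r) g k y) (\sum_(k <- r) dg k x).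
Proof.
move=> H; elim: r => [|p r IH].
  rewrite big_nil; have -> : (fun y => \sum_(k <- [::]) g k y) = cst 0.
    by apply/funext => y; rewrite big_nil.
  exact: is_derive_cst.
rewrite big_cons.
have -> : (fun y => \sum_(k <- p :: r) g k y)
  = (g p \+ (fun y => \sum_(k <- r) g k y)).
  by apply/funext => y; rewrite big_cons.
exact: is_deriveD.
Qed.

(** With the factorial included, differentiating along axis [i] lowers the index by [munit i]
    without producing a coefficient. *)
Definition mono k c : R := (\prod_(i < n) c 0 i ^+ k i) / (mfact k)%:R.

Lemma mfact_gt0 k : (0 < mfact k)%N.
Proof. by rewrite prodn_gt0// => i; rewrite fact_gt0. Qed.

Lemma mfact_sub k i : (0 < k i)%N ->
  mfact k = (k i * mfact (msub k (munit i)))%N.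
Proof.
move=> ki; rewrite /mfact (bigD1 i)//= [in RHS](bigD1 i)//= !ffunE eqxx.
rewrite mulnA; congr (_ * _)%N; first by case: (k i) ki => // p _; rewrite subn1 factS.
by apply: eq_bigr => j /negbTE ji; rewrite !ffunE ji subn0.
Qed.

Lemma mono_zero c : mono (mnil n) c = 1.
Proof.
rewrite /mono /mfact !big1 ?divr1// => i _; rewrite ffunE//.
Qed.

Lemma mono_at0 k : mdeg k != 0%N -> mono k 0 = 0.
Proof.
rewrite /mdeg sum_nat_eq0 negb_forall => /existsP[i /= ki].
by rewrite /mono (bigD1 i)//= mxE expr0n (negbTE ki) !mul0r.
Qed.

Lemma is_derive_mono k c i : is_derive c (e i) (mono k)
  (if (0 < k i)%N then mono (msub k (munit i)) c else 0).
Proof.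
apply: is_derive_from_axis.
pose K : R := (\prod_(j < n | j != i) c 0 j ^+ k j) / (mfact k)%:R.
have -> : (fun t : R => mono k (c + t *: e i))
    = horner (K *: ('X + (c 0 i)%:P) ^+ k i).
  apply/funext => t; rewrite /mono (bigD1 i)//= !mxE /= eqxx mulr1 !hornerE.
  rewrite /K -mulrA mulrC; congr (_ * _); last by rewrite addrC.
  congr (_ / _); apply: eq_bigr => j /negbTE ji.
  by rewrite !mxE /= ji mulr0 addr0.
apply: is_derive_eq; rewrite derivZ deriv_exp derivD derivX derivC addr0 mul1r.
rewrite hornerZ hornerMn horner_exp hornerD hornerX hornerC add0r.
case: ifPn => [ki|]; last by rewrite -eqn0Ngt => /eqP ->; rewrite mulr0n mulr0.
have kn0 : (k i)%:R != 0 :> R by rewrite pnatr_eq0 -lt0n.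
have fn0 : (mfact (msub k (munit i)))%:R != 0 :> R.
  by rewrite pnatr_eq0 -lt0n mfact_gt0.
rewrite /K /mono (mfact_sub ki) [in RHS](bigD1 i)//= !ffunE eqxx subn1.
rewrite natrM -mulr_natr [in RHS](eq_bigr (fun p => c 0 p ^+ k p)); last first.
  by move=> j /negbTE ji; rewrite !ffunE ji subn0.
by field; rewrite fn0 kn0.
Qed.

(** Base point and increment are separate arguments because the remainder is later differentiated in
    each of them. *)
Definition taylor m f b c : R := \sum_(k <- midx n m) partial_multi k f b * mono k c.
Definition taylor_rem m f b c : R := f (b + c) - taylor m f b c.

Lemma is_derive_scale (V : normedModType R) (a : R) (g : V -> R) (x v : V) d :
  is_derive x v g d -> is_derive x v (fun y => a * g y) (a * d).
Proof. exact: is_deriveZ. Qed.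

Lemma is_derive_taylor m f b c i : Cm m.+1 f ->
  is_derive c (e i) (taylor m.+1 f b) (taylor m (partial i f) b c).
Proof.
move=> Cf; rewrite /taylor.
have -> : \sum_(k <- midx n m) partial_multi k (partial i f) b * mono k c
  = \sum_(k <- midx n m.+1) partial_multi k f b *
      (if (0 < k i)%N then mono (msub k (munit i)) c else 0).
  rewrite [RHS](bigID (mle (munit i))) /= [X in _ + X]big1 ?addr0; last first.
    by move=> k; rewrite mle_unit => /negbTE ->; rewrite mulr0.
  have -> : m.+1 = (mdeg (munit i) + m)%N by rewrite mdeg_unit.
  rewrite big_midx_shift.
  rewrite big_seq [RHS]big_seq; apply: eq_bigr => k; rewrite mem_midx => km.
  have -> : (0 < madd (munit i) k i)%N by rewrite -mle_unit mle_madd.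
  rewrite msub_madd partial_multi_munit//.
  exact: (Cm_le _ Cf).
apply: (@is_derive_bigsum _ _ _ (fun k y => partial_multi k f b * mono k y)
  (fun k y => partial_multi k f b *
      (if (0 < k i)%N then mono (msub k (munit i)) y else 0))) => k.
exact/is_derive_scale/is_derive_mono.
Qed.

Lemma is_derive_taylor_base m f b c i : Cm m.+1 f ->
  is_derive b (e i) (fun b => taylor m f b c) (taylor m (partial i f) b c).
Proof.
move=> Cf; rewrite /taylor big_seq.
(* [is_derive_bigsum] asks for the derivative of the term of every index, while only the derivatives
   of [f] up to order [m] are known to be differentiable. The guard makes the other terms zero. *)
have -> : (fun b => \sum_(k <- midx n m) partial_multi k f b * mono k c)
  = (fun b => \sum_(k <- midx n m) (if (mdeg k <= m)%N then
         mono k c * partial_multi k f b else 0)).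
  apply/funext => y; rewrite big_seq [RHS]big_seq; apply: eq_bigr => k.
  by rewrite mem_midx => ->; rewrite mulrC.
have -> : \sum_(k <- midx n m | k \in midx n m) partial_multi k (partial i f) b * mono k c
  = \sum_(k <- midx n m) (if (mdeg k <= m)%N then
         mono k c * partial_multi k (partial i f) b else 0).
  rewrite [RHS]big_seq; apply: eq_bigr => k.
  by rewrite mem_midx => ->; rewrite mulrC.
apply: (@is_derive_bigsum _ _ _ (fun k b => if (mdeg k <= m)%N then
         mono k c * partial_multi k f b else 0)
  (fun k b => if (mdeg k <= m)%N then
         mono k c * partial_multi k (partial i f) b else 0)) => k.
case: leqP => km; last exact: is_derive_cst.
apply: is_derive_scale; rewrite -partial_multi_comm; last exact: (Cm_le _ Cf).
apply/derivableP/(@Cm_derivable _ _ 0)/Cm_multi; apply: (Cm_le _ Cf).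
by rewrite addn1.
Qed.

Lemma is_derive_shiftv f b c (v : 'rV[R]_n) d :
  is_derive (b + c) v f d -> is_derive c v (fun y => f (b + y)) d.
Proof.
have E : (fun h : R => h^-1 *: (((fun y => f (b + y)) \o shift c) (h *: v) - f (b + c)))
       = (fun h : R => h^-1 *: ((f \o shift (b + c)) (h *: v) - f (b + c))).
  by apply/funext => h /=; rewrite addrCA.
by case=> df vf; split; move: df vf; rewrite /derivable /derive E.
Qed.

(** Differentiating in the increment lowers the order of the remainder by one, which drives the
    induction of [rem_bound]. *)
Lemma is_derive_rem m f b c i : Cm m.+1 f ->
  is_derive c (e i) (taylor_rem m.+1 f b) (taylor_rem m (partial i f) b c).
Proof.
move=> Cf; apply: is_deriveB; last exact: is_derive_taylor.
apply: is_derive_shiftv; apply/derivableP; exact: (Cm_derivable Cf).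
Qed.

(** Differentiating in the base point keeps the order [m], so it costs one derivative of [f]. This
    is the source of the stronger regularity in the Lipschitz bounds. *)
Lemma is_derive_rem_base m f b c i : Cm m.+1 f ->
  is_derive b (e i) (fun b => taylor_rem m f b c) (taylor_rem m (partial i f) b c).
Proof.
move=> Cf; apply: is_deriveB; last exact: is_derive_taylor_base.
have -> : (fun b => f (b + c)) = (fun b => f (c + b)).
  by apply/funext => y; rewrite addrC.
rewrite [b + c]addrC.
apply: is_derive_shiftv; apply/derivableP; exact: (Cm_derivable Cf).
Qed.

Lemma taylor0 f b c : taylor 0 f b c = f b.
Proof. by rewrite /taylor midx0 big_seq1 partial_multi0 mono_zero mulr1. Qed.

Lemma taylor_at0 m f b : taylor m f b 0 = f b.
Proof.
rewrite /taylor (bigID (fun k => mdeg k == 0%N)) /= [X in _ + X]big1; last first.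
  by move=> k km; rewrite mono_at0 ?mulr0.
rewrite addr0 -big_filter.
rewrite (_ : [seq _ <- _ | _] = [:: mnil n]).
  by rewrite big_seq1 partial_multi0 mono_zero mulr1.
rewrite -midx0; apply: perm_small_eq; rewrite ?midx0//.
rewrite -midx0; apply: uniq_perm; rewrite ?filter_uniq ?midx_uniq// => k.
by rewrite mem_filter !mem_midx leqn0; case: eqP => // ->.
Qed.

Lemma rem_at0 m f b : taylor_rem m f b 0 = 0.
Proof. by rewrite /taylor_rem taylor_at0 addr0 subrr. Qed.

End TaylorRemainder.

Section HolderTaylor.
Variables (R : realType) (n : nat).
Implicit Types (f : 'rV[R]_n -> R) (b c x : 'rV[R]_n).
Implicit Types (k l j : {ffun 'I_n -> nat}) (i : 'I_n).

Local Notation e i := (delta_mx 0 i : 'rV[R]_n).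

Lemma compact_row_ball (r : R) : compact [set x : 'rV[R]_n | `|x| <= r].
Proof.
apply: bounded_closed_compact.
  by exists r; split=> [|M rM x /= xr]; rewrite ?num_real// (le_trans xr)// ltW.
rewrite (_ : [set x | _] = Num.norm @^-1` [set y : R | y <= r])//.
by apply: closed_comp => [x _|]; [exact: norm_continuous|exact: closed_le].
Qed.

Lemma continuous_ball_bounded f (r : R) : continuous f ->
  exists2 C, 0 <= C & forall x, `|x| <= r -> `|f x| <= C.
Proof.
move=> cf.
have /compact_bounded[M [_ HM]] : compact (f @` [set x | `|x| <= r]).
  by apply: continuous_compact (@compact_row_ball r); apply: continuous_subspaceT.
exists (`|M| + 1); first by rewrite addr_ge0.
move=> x xr; apply: (HM (`|M| + 1)); last by exists x.
by rewrite (le_lt_trans (ler_norm M))// ltrDl.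
Qed.

Definition holder_class m (theta : R) f := Cm m f /\
  forall k, mdeg k = m -> forall r : R, exists2 C, 0 <= C &
    forall x y, `|x| <= r -> `|y| <= r ->
      `|partial_multi k f x - partial_multi k f y| <= C * `|x - y| `^ theta.

Lemma holder_class_space (kappa : R) f : holder_space kappa f ->
  exists (m : nat) (theta : R),
    [/\ 0 < theta, theta <= 1, kappa = m%:R + theta & holder_class m theta f].
Proof.
move=> [m [mk km Cf H]]; exists m, (kappa - m%:R); split => //.
- by rewrite subr_gt0.
- by rewrite lerBlDl natr1.
- by rewrite addrC subrK.
split => // k km' r; have [C HC] := H k km' _ (@compact_row_ball r).
exists `|C| => // x y xr yr; apply: (le_trans (HC x y xr yr)).
by rewrite ler_wpM2r ?powR_ge0 ?ler_norm.
Qed.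

Lemma holder_class_partial m theta f i :
  holder_class m.+1 theta f -> holder_class m theta (partial i f).
Proof.
move=> [Cf H]; split; first exact: Cm_partial Cf.
move=> k km r; rewrite -partial_multi_munit ?km//.
by apply: H; rewrite mdegD mdeg_unit km.
Qed.

Lemma holder_class_multi m theta f l :
  holder_class (mdeg l + m) theta f -> holder_class m theta (partial_multi l f).
Proof.
move=> [Cf H]; split; first exact: Cm_multi.
move=> k km r; rewrite -partial_multiD ?km 1?addnC//.
by apply: H; rewrite mdegD km addnC.
Qed.

Lemma Cm_holder_class m f : Cm m.+1 f -> holder_class m 1 f.
Proof.
move=> Cf; split; first exact: (Cm_le _ Cf).
move=> k km r.
have C1 : Cm 1 (partial_multi k f) by apply: Cm_multi; rewrite km addn1.
have /fin_all_exists2[C C0 HC] i : exists2 C, 0 <= C & forall x, `|x| <= r ->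
    `|partial i (partial_multi k f) x| <= C.
  exact/continuous_ball_bounded/(@Cm_continuous _ _ 0)/Cm_partial.
exists ((\sum_i C i) * n%:R); first by rewrite mulr_ge0 ?sumr_ge0.
move=> x y xr yr; rewrite powRr1//; apply: (@lipschitz_ball_partial _ _ _ r) => //.
  by move=> w i; apply: Cm_derivable C1.
move=> w i wr; apply: (le_trans (HC i w wr)).
by rewrite (bigD1 i)//= lerDl sumr_ge0.
Qed.

(** By induction on [m]: the partial derivatives of the remainder in [c] are remainders of order one
    less, hence O(|c|^(m + theta)), and the remainder vanishes at [c = 0]. Integrating over the ball
    of radius |c| gains one power of |c|. *)
Lemma rem_bound m theta f : 0 < theta -> holder_class m theta f ->
  forall r : R, exists2 C, 0 <= C & forall b c, `|b| <= r -> `|c| <= r ->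
    `|taylor_rem m f b c| <= C * `|c| `^ (m%:R + theta).
Proof.
move=> t0; elim: m f => [|m IH] f hf r.
  have [C C0 HC] := hf.2 _ (@mdeg_zero n) (r + r); exists C => // b c br cr.
  rewrite /taylor_rem taylor0 add0r -[f]partial_multi0.
  have := HC (b + c) b; rewrite partial_multi0 [b + c - b]addrAC subrr add0r.
  apply; first by rewrite (le_trans (ler_normD _ _))// lerD.
  by rewrite (le_trans br)// lerDr (le_trans _ br).
have /fin_all_exists2[C C0 HC] i := IH _ (holder_class_partial i hf) r.
exists ((\sum_i C i) * n%:R); first by rewrite mulr_ge0 ?sumr_ge0.
move=> b c br cr.
have H w i : `|w| <= `|c| ->
    `|partial i (taylor_rem m.+1 f b) w| <= (\sum_i C i) * `|c| `^ (m%:R + theta).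
  move=> wc; rewrite /partial.
  have -> := @derive_val _ _ _ _ _ _ _ (is_derive_rem b w i hf.1).
  apply: (le_trans (HC i b w br (le_trans wc cr))); apply: ler_pM => //.
  - by rewrite (bigD1 i)//= lerDl sumr_ge0.
  - by apply: ge0_ler_powR; rewrite ?nnegrE// addr_ge0 ?ler0n// ltW.
have dr w i : derivable (taylor_rem m.+1 f b) w (e i).
  exact: @ex_derive _ _ _ _ _ _ _ (is_derive_rem b w i hf.1).
have := lipschitz_ball_partial dr H (lexx _) (_ : `|0| <= `|c|).
rewrite rem_at0 !subr0 normr0 => /(_ (normr_ge0 _))/le_trans; apply.
rewrite (mulrAC (\sum_i C i)) -[leLHS]mulrA ler_wpM2l//.
  by rewrite mulr_ge0 ?sumr_ge0.
have [->|c0] := eqVneq `|c| 0; first by rewrite mulr0 powR_ge0.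
by rewrite -natr1 [m%:R + 1 + _]addrAC [leRHS]powRD ?c0 ?implybT// powRr1.
Qed.

(** For positive [m] the derivative is a remainder of order [m - 1] of a function with one more
    continuous derivative, so [rem_bound] applies with exponent [theta = 1]. For [m = 0] it is a
    derivative of [f] at [b + c], which is merely bounded. *)
Lemma rem_partial_bound m f : Cm m.+1 f ->
  forall r : R, exists2 C, 0 <= C & forall b c i, `|b| <= r -> `|c| <= r ->
    derivable (taylor_rem m f b) c (e i) /\
    `|partial i (taylor_rem m f b) c| <= C * `|c| ^+ m.
Proof.
case: m => [|m] Cf r.
  have /fin_all_exists2[C C0 HC] i : exists2 C, 0 <= C & forall x,
      `|x| <= r + r -> `|partial i f x| <= C.
    exact/continuous_ball_bounded/(@Cm_continuous _ _ 0)/Cm_partial.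
  exists (\sum_i C i) => [|b c i br cr]; first exact: sumr_ge0.
  have D : is_derive c (e i) (taylor_rem 0 f b) (partial i f (b + c) - 0).
    rewrite (_ : taylor_rem 0 f b = (fun c => f (b + c)) \- cst (f b)); last first.
      by apply/funext => y; rewrite /taylor_rem taylor0.
    apply: is_deriveB; first exact/is_derive_shiftv/derivableP/(Cm_derivable Cf).
  split; first by case: D.
  rewrite expr0 mulr1 /partial (@derive_val _ _ _ _ _ _ _ D) subr0.
  apply: (@le_trans _ _ (C i)); last by rewrite (bigD1 i)//= lerDl sumr_ge0.
  by apply: HC; rewrite (le_trans (ler_normD _ _))// lerD.
have /fin_all_exists2[C C0 HC] i :=
  rem_bound ltr01 (Cm_holder_class (Cm_partial i Cf)) r.
exists (\sum_i C i) => [|b c i br cr]; first exact: sumr_ge0.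
have D := is_derive_rem b c i (Cm_le (leqnSn _) Cf).
split; first by case: D.
rewrite /partial (@derive_val _ _ _ _ _ _ _ D).
apply: (le_trans (HC i b c br cr)); rewrite natr1 powR_mulrn// ler_wpM2r ?exprn_ge0//.
by rewrite (bigD1 i)//= lerDl sumr_ge0.
Qed.

(** The increment is changed first, at fixed [b], then the base point, at fixed [c']. A common bound
    [rho] on both increments is kept as a parameter because it will be a multiple of [delta ^ z],
    and its powers give the order of the remainder. *)
Lemma rem_lipschitz m theta f : 0 < theta -> holder_class m.+1 theta f ->
  forall r : R, exists2 C, 0 <= C & forall b b' c c' (rho : R),
    `|b| <= r -> `|b'| <= r -> `|c| <= rho -> `|c'| <= rho -> rho <= r ->
    `|taylor_rem m f b c - taylor_rem m f b' c'|
      <= C * (rho ^+ m * `|c - c'| + rho `^ (m%:R + theta) * `|b - b'|).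
Proof.
move=> t0 hf r.
have [C C0 HC] := rem_partial_bound hf.1 r.
have /fin_all_exists2[D D0 HD] i := rem_bound t0 (holder_class_partial i hf) r.
have SD0 : 0 <= \sum_i D i by exact: sumr_ge0.
exists ((C + \sum_i D i) * n%:R); first by rewrite mulr_ge0 ?addr_ge0.
move=> b b' c c' rho br b'r crho c'rho rhor.
have rho0 : 0 <= rho by apply: le_trans crho.
rewrite -(subrK (taylor_rem m f b c') (taylor_rem m f b c)) -addrA.
rewrite (le_trans (ler_normD _ _))// mulrDr lerD//.
  have dr w i : derivable (taylor_rem m f b) w (e i).
    have [C' _ /(_ b w i)[]//] := rem_partial_bound hf.1 (`|b| + `|w|).
    - by rewrite lerDl.
    - by rewrite lerDr.
  have bdr w i : `|w| <= rho -> `|partial i (taylor_rem m f b) w| <= C * rho ^+ m.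
    move=> wr; have [_ dwb] := HC b w i br (le_trans wr rhor).
    by apply: (le_trans dwb); rewrite ler_wpM2l// lerXn2r ?nnegrE.
  apply: (le_trans (lipschitz_ball_partial dr bdr crho c'rho)).
  rewrite [leRHS]mulrA ler_wpM2r// mulrAC ler_wpM2r ?exprn_ge0//.
  by rewrite ler_wpM2r// lerDl.
have dr w i : derivable (fun b => taylor_rem m f b c') w (e i).
  exact: @ex_derive _ _ _ _ _ _ _ (is_derive_rem_base w c' i hf.1).
have bdr w i : `|w| <= r -> `|partial i (fun b => taylor_rem m f b c') w|
    <= (\sum_i D i) * rho `^ (m%:R + theta).
  move=> wr; rewrite /partial.
  rewrite (@derive_val _ _ _ _ _ _ _ (is_derive_rem_base w c' i hf.1)).
  apply: (le_trans (HD i w c' wr (le_trans c'rho rhor))); apply: ler_pM => //.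
  - by rewrite (bigD1 i)//= lerDl sumr_ge0.
  - by apply: ge0_ler_powR; rewrite ?nnegrE// addr_ge0 ?ler0n// ltW.
apply: (le_trans (lipschitz_ball_partial dr bdr br b'r)).
rewrite [leRHS]mulrA ler_wpM2r// mulrAC ler_wpM2r ?powR_ge0//.
by rewrite ler_wpM2r// lerDr.
Qed.

End HolderTaylor.

(** * The product and the binomial expansion *)

Section StarRing.
Variables (R : realType) (S : regularity_structure R) (star : product S).

(** A copy of the model space that remembers the product, so that each product has its own ring
    structure and the ring lemmas apply to [star]. *)
Definition star_alg (p : product S) : Type := rs_type S.
Local Notation T := (star_alg star).

HB.instance Definition _ := GRing.Lmodule.on (star_alg star).

Lemma starDl u v w : star (u + v) w = star u w + star v w.
Proof. by have := pr_linear_l star w 1 u v; rewrite /= !scale1r. Qed.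

Lemma starDr u v w : star u (v + w) = star u v + star u w.
Proof. by have := pr_linear_r star u 1 v w; rewrite /= !scale1r. Qed.

Lemma star0l w : star 0 w = 0.
Proof. by apply: (addrI (star 0 w)); rewrite -starDl !addr0. Qed.

Lemma star0r w : star w 0 = 0.
Proof. by rewrite pr_comm star0l. Qed.

Lemma starZl c u w : star (c *: u) w = c *: star u w.
Proof. by have := pr_linear_l star w c u 0; rewrite star0l !addr0. Qed.

Lemma starZr c u w : star w (c *: u) = c *: star w u.
Proof. by rewrite pr_comm starZl pr_comm. Qed.

Lemma starBl u v w : star (u - v) w = star u w - star v w.
Proof. by rewrite starDl -scaleN1r starZl scaleN1r. Qed.

Lemma starBr u v w : star w (u - v) = star w u - star w v.
Proof. by rewrite pr_comm starBl !(pr_comm star w). Qed.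

Lemma star_suml (I : Type) (r : seq I) (P : pred I) (F : I -> rs_type S) w :
  star (\sum_(i <- r | P i) F i) w = \sum_(i <- r | P i) star (F i) w.
Proof. exact: (big_morph (star^~ w) (fun u v => starDl u v w) (star0l w)). Qed.

Lemma star_sumr (I : Type) (r : seq I) (P : pred I) (F : I -> rs_type S) w :
  star w (\sum_(i <- r | P i) F i) = \sum_(i <- r | P i) star w (F i).
Proof. exact: (big_morph (star w) (starDr w) (star0r w)). Qed.

HB.instance Definition _ := GRing.Zmodule_isComPzRing.Build T
  (@pr_assoc _ _ star) (@pr_comm _ _ star) (@pr_unitl _ _ star)
  (fun u v w => starDl u v w).

Lemma star_powE n (u : 'I_n -> T) k : star_pow star u k = \prod_i u i ^+ k i.
Proof.
rewrite /star_pow; apply: eq_bigr => i _; elim: (k i) => //= p ->.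
by rewrite exprS.
Qed.

Lemma scale_unit_exp (c : R) p : (c *: (1 : T)) ^+ p = c ^+ p *: (1 : T).
Proof.
elim: p => [|p IH]; first by rewrite !expr0 scale1r.
rewrite !exprS IH; have -> : forall x y : T, x * y = star x y by [].
by rewrite starZl pr_unitl scalerA.
Qed.

Lemma scale_unit_prod (I : Type) (r : seq I) (c : I -> R) (w : I -> T) :
  \prod_(i <- r) (c i *: w i) = (\prod_(i <- r) c i) *: \prod_(i <- r) w i.
Proof.
elim: r => [|i r IH]; first by rewrite !big_nil scale1r.
rewrite !big_cons IH; have E : forall x y : T, x * y = star x y by [].
by rewrite !E starZl starZr scalerA.
Qed.

Lemma star_pow_binomial n m (u : 'I_n -> T) (c : 'rV[R]_n) k : (mdeg k <= m)%N ->
  ((mfact k)%:R^-1 : R) *: star_pow star (fun i => u i + c 0 i *: rs_unit S) k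
  = \sum_(l <- midx n m | mle l k)
      (mono (msub k l) c / (mfact l)%:R) *: star_pow star u l.
Proof.
move=> km; rewrite star_powE.
have ki i : (k i <= m)%N.
  by apply: leq_trans km; rewrite /mdeg (bigD1 i)//= leq_addr.
(* All binomial sums are extended to the common range p <= m, where the additional binomial
   coefficients are zero. The product of the sums then distributes into one sum over functions into
   ['I_m.+1], the type behind [midx]. *)
have EC (x y : T) i : (x + y) ^+ k i =
    \sum_(p < m.+1) (y ^+ (k i - p) * x ^+ p) *+ 'C(k i, p).
  rewrite addrC exprDn.
  rewrite (big_ord_widen m.+1 (fun p => (y ^+ (k i - p) * x ^+ p) *+ 'C(k i, p)));
    last by rewrite ltnS.
  rewrite [RHS](bigID (fun p : 'I_m.+1 => (p < (k i).+1)%N)) /= [X in _ + X]big1 ?addr0//.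
  by move=> p; rewrite -leqNgt => kp; rewrite bin_small ?mulr0n.
under eq_bigr => i _ do rewrite EC.
rewrite bigA_distr_bigA /=.
pose toN (h : {ffun 'I_n -> 'I_m.+1}) : {ffun 'I_n -> nat} := [ffun i => nat_of_ord (h i)].
pose G (l : {ffun 'I_n -> nat}) : T := (mfact k)%:R^-1 *:
  \prod_i (((c 0 i *: (1 : T)) ^+ (k i - l i) * u i ^+ l i) *+ 'C(k i, l i)).
have G0 l : ~~ mle l k -> G l = 0.
  rewrite negb_forall => /existsP[i]; rewrite -ltnNge => li.
  by rewrite /G (bigD1 i)//= bin_small// mulr0n mul0r scaler0.
rewrite scaler_sumr.
rewrite (eq_bigr (fun h : {ffun 'I_n -> 'I_m.+1} => G (toN h))); last first.
  by move=> h _; congr (_ *: _); apply: eq_bigr => i _; rewrite ffunE.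
rewrite [LHS](bigID (fun h : {ffun 'I_n -> 'I_m.+1} => (\sum_i h i <= m)%N)) /=.
rewrite [X in _ + X]big1 ?addr0; last first.
  move=> h hm; apply: G0; apply: contra hm => /mdeg_le.
  rewrite {1}/mdeg (eq_bigr (fun i => nat_of_ord (h i))) => [|i _]; last by rewrite ffunE.
  by move/leq_trans; apply.
transitivity (\sum_(l <- midx n m) G l).
  by rewrite /midx big_map big_filter big_enum_cond.
rewrite (bigID (fun l => mle l k)) /= [X in _ + X]big1 ?addr0//.
apply: eq_bigr => l /mleP lk.
rewrite /G star_powE.
rewrite (eq_bigr (fun i => (c 0 i ^+ (k i - l i) *+ 'C(k i, l i)) *: u i ^+ l i)); last first.
  move=> i _; rewrite scale_unit_exp.
  have E : forall x y : T, x * y = star x y by [].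
  by rewrite E starZl pr_unitl scalerMnl.
rewrite scale_unit_prod scalerA; congr (_ *: _).
rewrite /mono.
have fN p : (p`!)%:R != 0 :> R by rewrite pnatr_eq0 -lt0n fact_gt0.
rewrite /mfact !natr_prod -!prodfV -!big_split /=; apply: eq_bigr => i _.
rewrite -mulr_natr -(bin_fact (lk i)) !ffunE !natrM.
have CN : 'C(k i, l i)%:R != 0 :> R by rewrite pnatr_eq0 -lt0n bin_gt0.
by field; rewrite !fN CN.
Qed.

(** The binomial formula followed by the substitution k = l + j. When [D] lists the derivatives of F
    at a point, the coefficient of u^l / l! is the Taylor polynomial of D^l F of order m - |l|. *)
Lemma star_taylor n m (D : {ffun 'I_n -> nat} -> R) (u : 'I_n -> T) (c : 'rV[R]_n) :
  \sum_(k <- midx n m)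
     (D k / (mfact k)%:R) *: star_pow star (fun i => u i + c 0 i *: rs_unit S) k
  = \sum_(l <- midx n m)
     ((\sum_(j <- midx n (m - mdeg l)) D (madd l j) * mono j c) / (mfact l)%:R)
       *: star_pow star u l.
Proof.
rewrite big_seq; under eq_bigr => k.
  rewrite mem_midx => km; rewrite -scalerA (star_pow_binomial _ _ km).
  rewrite scaler_sumr; over.
rewrite -big_seq (exchange_big_dep xpredT)//= big_seq [RHS]big_seq.
apply: eq_bigr => l; rewrite mem_midx => lm.
rewrite -[in LHS](subnKC lm) big_midx_shift mulr_suml scaler_suml.
by apply: eq_bigr => j _; rewrite scalerA msub_madd mulrA.
Qed.

End StarRing.

(** * Components of elements of the model space *)

Section Components.
Variables (R : realType) (S : regularity_structure R).
Implicit Types (u v : rs_type S) (a b c g : R).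

Lemma dcompD u v a : (u + v) a = u a + v a. Proof. by []. Qed.
Lemma dcompB u v a : (u - v) a = u a - v a. Proof. by []. Qed.
Lemma dcompZ (k : R) u a : (k *: u) a = k *: u a. Proof. by []. Qed.

Lemma dcomp_sum (I : Type) (r : seq I) (P : pred I) (F : I -> rs_type S) a :
  (\sum_(i <- r | P i) F i) a = \sum_(i <- r | P i) F i a.
Proof. exact: (big_morph (fun u : rs_type S => u a)). Qed.

Lemma dinj_same a (x : rs_space S a) : dinj x a = x.
Proof.
rewrite /= /dinj_fun; case: pselect => // e.
by rewrite (Prop_irrelevance e erefl).
Qed.

Lemma dinj_other a (x : rs_space S a) b : b <> a -> dinj x b = 0.
Proof. by move=> ba; rewrite /= /dinj_fun; case: pselect => // e; case: ba. Qed.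

Lemma dinjD a (x y : rs_space S a) : dinj (x + y) = dinj x + dinj y.
Proof.
apply: dsumP => b; rewrite dcompD; have [->|/eqP ba] := eqVneq b a.
  by rewrite !dinj_same.
by rewrite !dinj_other ?addr0.
Qed.

Lemma dinjZ a (k : R) (x : rs_space S a) : dinj (k *: x) = k *: dinj x.
Proof.
apply: dsumP => b; rewrite dcompZ; have [->|/eqP ba] := eqVneq b a.
  by rewrite !dinj_same.
by rewrite !dinj_other ?scaler0.
Qed.

Lemma dinj0 a : dinj (0 : rs_space S a) = 0.
Proof. by rewrite -(scale0r (0 : rs_space S a)) dinjZ scale0r. Qed.

Lemma dsum_decomp (r : seq R) u : uniq r -> (forall a, u a != 0 -> a \in r) ->
  u = \sum_(a <- r) dinj (u a).
Proof.
move=> ur hr; apply: dsumP => b; rewrite dcomp_sum.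
have [br|br] := boolP (b \in r).
  rewrite (bigD1_seq b)//= big1 ?addr0 -?[RHS]/(dinj (u b) b) ?dinj_same//.
  by move=> a ab; apply: dinj_other; apply/eqP; rewrite eq_sym.
rewrite big_seq big1 => [|a ar].
  by apply: contraNeq br; apply: hr.
by apply: dinj_other; apply/eqP; apply: contraNneq br => ->.
Qed.

Lemma dtruncD g u v : dtrunc g (u + v) = dtrunc g u + dtrunc g v.
Proof. by apply: dsumP => a; rewrite /=; case: ifP => //; rewrite addr0. Qed.

Lemma dtrunc0 g : dtrunc g (0 : rs_type S) = 0.
Proof. by apply: dsumP => a; rewrite /=; case: ifP. Qed.

Lemma dtrunc_sum g (I : Type) (r : seq I) (P : pred I) (F : I -> rs_type S) :
  dtrunc g (\sum_(i <- r | P i) F i) = \sum_(i <- r | P i) dtrunc g (F i).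
Proof. exact: (big_morph (dtrunc g) (dtruncD g) (dtrunc0 g)). Qed.

Lemma dtruncZ g (k : R) u : dtrunc g (k *: u) = k *: dtrunc g u.
Proof. by apply: dsumP => a; rewrite /=; case: ifP => //; rewrite scaler0. Qed.

Lemma dtrunc_lt g u a : a < g -> dtrunc g u a = u a.
Proof. by move=> ag; rewrite /= ag. Qed.

Lemma dtrunc_ge g u a : g <= a -> dtrunc g u a = 0.
Proof. by rewrite leNgt /= => /negbTE ->. Qed.

Lemma dtrunc_id g u : dlt g u -> dtrunc g u = u.
Proof.
by move=> ug; apply: dsumP => a /=; case: ltP => // /ug ->.
Qed.

Lemma rs_coefE u : u 0 = rs_coef u *: rs_one S.
Proof.
rewrite /rs_coef; case: xgetP => [c _ //|H].
by have [c uc] := rs_one_span (u 0); case: (H c).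
Qed.

Lemma rs_one_neq0 : rs_one S != 0.
Proof. by rewrite -normr_eq0 rs_one_norm oner_neq0. Qed.

Lemma rs_coef_norm u : `|rs_coef u| = `|u 0|.
Proof. by rewrite rs_coefE normrZ rs_one_norm mulr1. Qed.

Lemma rs_coefP u (c : R) : u 0 = c *: rs_one S -> rs_coef u = c.
Proof.
rewrite rs_coefE => /eqP; rewrite -subr_eq0 -scalerBl scaler_eq0 subr_eq0.
by rewrite (negbTE rs_one_neq0) orbF => /eqP.
Qed.

Lemma rs_coefB u v : rs_coef (u - v) = rs_coef u - rs_coef v.
Proof. by apply: rs_coefP; rewrite dcompB !rs_coefE scalerBl. Qed.

Lemma rs_unit0 : rs_unit S 0 = rs_one S.
Proof. exact: dinj_same. Qed.

Lemma rs_unit_other a : a <> 0 -> rs_unit S a = 0.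
Proof. exact: dinj_other. Qed.

Lemma rs_tilde0 u : rs_tilde u 0 = 0.
Proof. by rewrite /rs_tilde dcompB dcompZ rs_unit0 rs_coefE subrr. Qed.

Lemma rs_tilde_other u a : a <> 0 -> rs_tilde u a = u a.
Proof.
by move=> a0; rewrite /rs_tilde dcompB dcompZ rs_unit_other// scaler0 subr0.
Qed.

Definition degs g : seq R :=
  [seq a <- finmap.enum_fset (fset_set (rs_index S `&` `[0, g])) | a < g].

Lemma degs_uniq g : uniq (degs g).
Proof. exact: (filter_uniq _ (finmap.fset_uniq _)). Qed.

Lemma mem_degs g a : (a \in degs g) <-> [/\ rs_index S a, 0 <= a & a < g].
Proof.
rewrite mem_filter in_fset_set; last exact: rs_index_locally_finite.
split => [/andP[ag]|[Sa a0 ag]].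
  by rewrite inE /= in_itv /= => -[Sa /andP[]].
by rewrite ag inE /= in_itv /= a0 (ltW ag).
Qed.

End Components.

Section Sector.
Variables (R : realType) (S : regularity_structure R) (V : function_like_sector S).
Implicit Types (u v : rs_type S) (a b c g : R).

Local Notation SV := (sector_set V).

Lemma sector0 : SV 0.
Proof. by move=> b; have [] := sec_subspace V b. Qed.

Lemma sectorDZ (k : R) u v : SV u -> SV v -> SV (k *: u + v).
Proof. by move=> hu hv b; have [_ h] := sec_subspace V b; apply: h. Qed.

Lemma sectorD u v : SV u -> SV v -> SV (u + v).
Proof. by move=> hu hv; rewrite -[u]scale1r; apply: sectorDZ. Qed.

Lemma sectorZ (k : R) u : SV u -> SV (k *: u).
Proof. by move=> hu; rewrite -[_ *: _]addr0; apply: sectorDZ => //; apply: sector0. Qed.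

Lemma sectorB u v : SV u -> SV v -> SV (u - v).
Proof. by move=> hu hv; rewrite -scaleN1r addrC; apply: sectorDZ. Qed.

Lemma sector_sum (I : Type) (r : seq I) (P : pred I) (F : I -> rs_type S) :
  (forall i, SV (F i)) -> SV (\sum_(i <- r | P i) F i).
Proof. by move=> h; apply: big_ind => //; [exact: sector0|exact: sectorD]. Qed.

Lemma sector_dinj a (x : rs_space S a) : sec_comp V x -> SV (dinj x).
Proof.
move=> hx b; have [ab|/eqP ba] := eqVneq b a; first by subst b; rewrite dinj_same.
by rewrite dinj_other//; exact: sector0.
Qed.

Lemma sector_trunc g u : SV u -> SV (dtrunc g u).
Proof. by move=> hu b /=; case: ifP => _; [exact: hu|exact: sector0]. Qed.

(** V_0 is a nonzero subspace of the line T_0, hence all of it. *)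
Lemma sector_unit : SV (rs_unit S).
Proof.
apply: sector_dinj; have [x [Vx x0]] : exists x, sec_comp V (b := 0) x /\ x <> 0.
  apply/not_existsP => h; apply: (@sec_zero _ _ V); apply/seteqP; split => x.
    by move=> Vx; apply: contrapT => x0; apply: (h x).
  by move=> ->; exact: sector0.
have [k xk] := rs_one_span x.
have k0 : k != 0 by apply: contra_notN x0 => /eqP k0; rewrite xk k0 scale0r.
have -> : rs_one S = k^-1 *: x + 0.
  by rewrite addr0 xk scalerA mulVf// scale1r.
by have [V0 VZ] := sec_subspace V 0; apply: VZ.
Qed.

Lemma sector_tilde u : SV u -> SV (rs_tilde u).
Proof. by move=> hu; apply: sectorB => //; apply: sectorZ; exact: sector_unit. Qed.

Lemma sector_neg u a : SV u -> a < 0 -> u a = 0.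
Proof. by move=> hu a0; have := hu a; rewrite (sec_neg V a0). Qed.

Lemma sector_degs g u a : SV u -> a < g -> u a != 0 -> a \in degs S g.
Proof.
move=> hu ag ua; apply/mem_degs; split => //.
- by apply: contrapT => Sa; move/eqP: ua; apply; apply: rs_space_trivial.
- by rewrite leNgt; apply: contraNN ua => a0; rewrite sector_neg.
Qed.

Lemma dtrunc_decomp g u : SV u -> dtrunc g u = \sum_(a <- degs S g) dinj (u a).
Proof.
move=> hu; rewrite {1}(@dsum_decomp _ _ (degs S g) (dtrunc g u)).
- rewrite big_seq [RHS]big_seq; apply: eq_bigr => a /mem_degs[_ _ ag].
  by rewrite dtrunc_lt.
- exact: degs_uniq.
move=> a; rewrite /=; case: ifP => [ag ua|]; last by rewrite eqxx.
exact: sector_degs hu ag ua.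
Qed.

End Sector.

Section StarBounds.
Variables (R : realType) (S : regularity_structure R) (star : product S).
Implicit Types (u v : rs_type S) (a b c g : R).

Lemma star_comp_bounded a b : exists2 C : R, 0 <= C &
  forall (x : rs_space S a) (y : rs_space S b),
    `|star (dinj x) (dinj y) (a + b)| <= C * `|x| * `|y|.
Proof.
pose B (x : rs_space S a) (y : rs_space S b) := star (dinj x) (dinj y) (a + b).
have B00 : B 0 0 = 0 by rewrite /B !dinj0 star0l.
have BZ (k k' : R) x y : B (k *: x) (k' *: y) = (k * k') *: B x y.
  by rewrite /B !dinjZ starZl starZr scalerA.
have := @pr_continuous _ _ star a b (0, 0).
move=> /cvgrPdist_lt/(_ 1 ltr01)/nbhs_ballP[r /= r0 H].
have {}H x y : `|x| < r -> `|y| < r -> `|B x y| < 1.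
  move=> xr yr; have := H (x, y).
  rewrite /= -/(B 0 0) B00 sub0r normrN; apply.
  by split; rewrite /= -ball_normE /ball_ /= sub0r normrN.
(* The two arguments are rescaled to norm [q^-1 = r / 2], inside the ball on which continuity at
   zero bounds [B] by 1. *)
pose q := 2 / r; have q0 : 0 < q by rewrite divr_gt0.
exists (q * q) => [|x y]; first by rewrite mulr_ge0 ?ltW.
rewrite -/(B x y).
have [->|x0] := eqVneq x 0; first by rewrite /B dinj0 star0l !normr0 mulr0 mul0r.
have [->|y0] := eqVneq y 0; first by rewrite /B dinj0 star0r !normr0 mulr0.
pose k := (q * `|x|)^-1; pose k' := (q * `|y|)^-1.
have nx : 0 < `|x| by rewrite normr_gt0.
have ny : 0 < `|y| by rewrite normr_gt0.
have k0 : 0 < k by rewrite invr_gt0 mulr_gt0.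
have k'0 : 0 < k' by rewrite invr_gt0 mulr_gt0.
have small : q^-1 < r by rewrite invf_div ltr_pdivrMr// ltr_pMr// ltr1n.
have kx : `|k *: x| < r.
  by rewrite normrZ gtr0_norm// /k invfM -mulrA mulVf ?gt_eqF// mulr1.
have ky : `|k' *: y| < r.
  by rewrite normrZ gtr0_norm// /k' invfM -mulrA mulVf ?gt_eqF// mulr1.
have := ltW (H _ _ kx ky); rewrite BZ normrZ gtr0_norm ?mulr_gt0//.
rewrite -ler_pdivlMl ?mulr_gt0// mulr1 => /le_trans; apply.
by rewrite invfM !invrK mulrACA mulrA.
Qed.

End StarBounds.

(** * Bounds for pairs of elements and their difference *)

Section Pairs.
Variable R : realType.

Definition pair_bound (E : normedModType R) (N e : R) (x y : E) :=
  [/\ `|x| <= N, `|y| <= N & `|x - y| <= N * e].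

Lemma pair_boundD (E : normedModType R) N M e (x y x' y' : E) :
  pair_bound N e x y -> pair_bound M e x' y' ->
  pair_bound (N + M) e (x + x') (y + y').
Proof.
move=> [h1 h2 h3] [k1 k2 k3]; split.
- by rewrite (le_trans (ler_normD _ _))// lerD.
- by rewrite (le_trans (ler_normD _ _))// lerD.
- by rewrite opprD addrACA (le_trans (ler_normD _ _))// mulrDl lerD.
Qed.

Lemma pair_bound_le (E : normedModType R) N M e (x y : E) : 0 <= e -> N <= M ->
  pair_bound N e x y -> pair_bound M e x y.
Proof.
move=> e0 NM [h1 h2 h3]; split; [exact: le_trans NM|exact: le_trans NM|].
by apply: (le_trans h3); rewrite ler_wpM2r.
Qed.

Lemma pair_bound0 (E : normedModType R) N e : 0 <= e -> 0 <= N ->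
  pair_bound N e (0 : E) 0.
Proof. by move=> e0 N0; split; rewrite ?subrr normr0// mulr_ge0. Qed.

Lemma pair_bound_diag (E : normedModType R) N e (x : E) : 0 <= e ->
  `|x| <= N -> pair_bound N e x x.
Proof.
move=> e0 xN; split => //; rewrite subrr normr0 mulr_ge0//.
exact: le_trans xN.
Qed.

(** The factor 2 comes from B(x, y) - B(x', y') = B(x - x', y) + B(x', y - y'). *)
Lemma pair_bound_bilinear (E E' E'' : normedModType R) (B : E -> E' -> E'')
    (C N M e : R) x x' y y' : 0 <= e -> 0 <= C ->
  (forall u v w, B (u - v) w = B u w - B v w) ->
  (forall u v w, B u (v - w) = B u v - B u w) ->
  (forall u v, `|B u v| <= C * `|u| * `|v|) ->
  pair_bound N e x x' -> pair_bound M e y y' ->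
  pair_bound (2 * C * N * M) e (B x y) (B x' y').
Proof.
move=> e0 C0 Bl Br HB [x1 x2 x3] [y1 y2 y3].
have N0 : 0 <= N by apply: le_trans x1.
have M0 : 0 <= M by apply: le_trans y1.
have P0 : 0 <= C * N * M by rewrite !mulr_ge0.
have bnd a b X Y : `|a| <= X -> `|b| <= Y -> `|B a b| <= C * X * Y.
  move=> aX bY; apply: (le_trans (HB a b)).
  by apply: ler_pM => //; rewrite ?mulr_ge0// ler_wpM2l.
have E2 : 2 * C * N * M = C * N * M + C * N * M by ring.
split.
- by rewrite (le_trans (bnd _ _ _ _ x1 y1))// E2 lerDl.
- by rewrite (le_trans (bnd _ _ _ _ x2 y2))// E2 lerDl.
have -> : B x y - B x' y' = B (x - x') y + B x' (y - y').
  by rewrite Bl Br addrA subrK.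
rewrite (le_trans (ler_normD _ _))// E2 mulrDl lerD//.
  by apply: (le_trans (bnd _ _ _ _ x3 y1)); rewrite le_eqVlt; apply/orP; left; apply/eqP; ring.
by apply: (le_trans (bnd _ _ _ _ x2 y3)); rewrite mulrA.
Qed.

Lemma pair_bound_scale (E : normedModType R) (N M e : R) (c d : R) (x y : E) : 0 <= e ->
  pair_bound N e c d -> pair_bound M e x y ->
  pair_bound (2 * N * M) e (c *: x) (d *: y).
Proof.
move=> e0 hc hx.
have := @pair_bound_bilinear R E E (fun c x => c *: x) 1 N M e c d x y e0 ler01.
rewrite mulr1; apply => // *; rewrite ?scalerBl ?scalerBr//.
by rewrite normrZ mul1r.
Qed.

Lemma pair_bound_linear (E E' : normedModType R) (B : E -> E') (C N e : R) x y :
  0 <= e -> 0 <= C -> (forall u v, B (u - v) = B u - B v) ->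
  (forall u, `|B u| <= C * `|u|) ->
  pair_bound N e x y -> pair_bound (C * N) e (B x) (B y).
Proof.
move=> e0 C0 Bl HB [h1 h2 h3]; split.
- by rewrite (le_trans (HB x))// ler_wpM2l.
- by rewrite (le_trans (HB y))// ler_wpM2l.
- by rewrite -Bl -mulrA (le_trans (HB _))// ler_wpM2l.
Qed.

Lemma pair_bound_sum (E : normedModType R) (I : eqType) (r : seq I) (N : I -> R) e
    (x y : I -> E) : 0 <= e ->
  (forall i, i \in r -> pair_bound (N i) e (x i) (y i)) ->
  pair_bound (\sum_(i <- r) N i) e (\sum_(i <- r) x i) (\sum_(i <- r) y i).
Proof.
move=> e0; elim: r => [|i r IH] h; first by rewrite !big_nil; apply: pair_bound0.
rewrite !big_cons; apply: pair_boundD; first by apply: h; rewrite mem_head.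
by apply: IH => k kr; apply: h; rewrite in_cons kr orbT.
Qed.

End Pairs.

(** * Orders of magnitude *)

Section Orders.
Variables (R : realType) (S : regularity_structure R) (star : product S).
Variables (V : function_like_sector S) (gamma : R).
Hypothesis V_star : product_invariant V star.
Hypothesis gamma_gt0 : 0 < gamma.
Variables (J : Type) (eps : J -> R).
Hypothesis eps_ge0 : forall j, 0 <= eps j.
Implicit Types (delta : J -> R) (u v w : J -> bool -> rs_type S).
Implicit Types (c : J -> bool -> R) (p q N : R).

Definition scale01 delta := forall j, 0 < delta j <= 1.

(* [u j true] and [u j false] are built in the same way from two modelled
   distributions at distance [eps j]. *)
Definition of_order delta p u :=
  (forall j b, sector_set V (u j b)) /\
  exists2 N, 0 <= N & forall j a, a < gamma ->
    pair_bound (N * delta j `^ (p - a)) (eps j) (u j true a) (u j false a).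

Definition scalar_order delta p c :=
  exists2 N, 0 <= N &
    forall j, pair_bound (N * delta j `^ p) (eps j) (c j true) (c j false).

Lemma powR_le1_anti (x p q : R) : 0 < x <= 1 -> p <= q -> x `^ q <= x `^ p.
Proof.
move=> /andP[x0 x1] pq; rewrite /powR gt_eqF// ler_expR ler_wnM2r//.
by rewrite -(@ln1 R) ler_ln ?posrE.
Qed.

Lemma scale01_powRD delta j p q : scale01 delta ->
  delta j `^ (p + q) = delta j `^ p * delta j `^ q.
Proof. by move=> /(_ j)/andP[d0 _]; rewrite powRD// (gt_eqF d0) /= implybT. Qed.

Lemma scale01_one : scale01 (fun=> 1).
Proof. by move=> j; rewrite ltr01 lexx. Qed.

Section FixedScale.
Variable delta : J -> R.
Hypothesis d01 : scale01 delta.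

(** An order only constrains components below [gamma], so truncations at [gamma] may be inserted or
    removed. *)
Lemma of_order_ext p u v : (forall j b, sector_set V (v j b)) ->
  (forall j b a, a < gamma -> v j b a = u j b a) ->
  of_order delta p u -> of_order delta p v.
Proof.
move=> hv E [_ [N N0 H]]; split => //; exists N => // j a ag.
by rewrite !E//; apply: H.
Qed.

Lemma of_order_eq p u v : (forall j b, u j b = v j b) ->
  of_order delta p u -> of_order delta p v.
Proof.
by move=> uv; rewrite (_ : u = v)//; apply/funext => j; apply/funext => b.
Qed.

Lemma of_order_weaken p q u : q <= p -> of_order delta p u -> of_order delta q u.
Proof.
move=> qp [hu [N N0 H]]; split => //; exists N => // j a ag.
apply: pair_bound_le (H j a ag) => //.
by rewrite ler_wpM2l// powR_le1_anti// lerD2r.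
Qed.

Lemma scalar_order_weaken p q c : q <= p ->
  scalar_order delta p c -> scalar_order delta q c.
Proof.
move=> qp [N N0 H]; exists N => // j; apply: pair_bound_le (H j) => //.
by rewrite ler_wpM2l// powR_le1_anti.
Qed.

Lemma of_order0 p : of_order delta p (fun _ _ => 0).
Proof.
split => [j b|]; first exact: sector0.
by exists 0 => // j a ag; apply: pair_bound0; rewrite ?mul0r.
Qed.

Lemma of_orderD p u v : of_order delta p u -> of_order delta p v ->
  of_order delta p (fun j b => u j b + v j b).
Proof.
move=> [hu [N N0 H]] [hv [M M0 K]]; split => [j b|]; first exact: sectorD.
exists (N + M) => [|j a ag]; first exact: addr_ge0.
by rewrite mulrDl; apply: pair_boundD; [exact: H|exact: K].
Qed.

Lemma of_order_sum p (I : eqType) (r : seq I) (F : I -> J -> bool -> rs_type S) :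
  (forall i, i \in r -> of_order delta p (F i)) ->
  of_order delta p (fun j b => \sum_(i <- r) F i j b).
Proof.
elim: r => [|i r IH] h.
  rewrite (_ : (fun _ _ => _) = (fun _ _ => 0)); first exact: of_order0.
  by apply/funext => j; apply/funext => b; rewrite big_nil.
rewrite (_ : (fun _ _ => _) = (fun j b => F i j b + \sum_(i <- r) F i j b)).
  apply: of_orderD; first by apply: h; rewrite mem_head.
  by apply: IH => k kr; apply: h; rewrite in_cons kr orbT.
by apply/funext => j; apply/funext => b; rewrite big_cons.
Qed.

Lemma of_order_scale p q c u : scalar_order delta p c -> of_order delta q u ->
  of_order delta (p + q) (fun j b => c j b *: u j b).
Proof.
move=> [N N0 H] [hu [M M0 K]]; split => [j b|]; first exact: sectorZ.
exists (2 * N * M) => [|j a ag]; first by rewrite !mulr_ge0.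
have -> : 2 * N * M * delta j `^ (p + q - a)
    = 2 * (N * delta j `^ p) * (M * delta j `^ (q - a)).
  by rewrite -addrA (scale01_powRD j p)//; ring.
by apply: pair_bound_scale => //; exact: K.
Qed.

Lemma scalar_order_cst p (k : R) : p <= 0 -> scalar_order delta p (fun _ _ => k).
Proof.
move=> p0; exists `|k| => // j; apply: pair_bound_diag => //.
rewrite ler_peMr//; have := powR_le1_anti (d01 j) p0.
by rewrite powRr0.
Qed.

Lemma of_orderB p u v : of_order delta p u -> of_order delta p v ->
  of_order delta p (fun j b => u j b - v j b).
Proof.
move=> hu hv.
rewrite (_ : (fun _ _ => _) = (fun j b => u j b + (-1 : R) *: v j b)).
  apply: of_orderD => //; rewrite -[p]add0r; apply: of_order_scale => //.
  exact: scalar_order_cst.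
by apply/funext => j; apply/funext => b; rewrite scaleN1r.
Qed.

Lemma scalar_orderM p q c c' : scalar_order delta p c -> scalar_order delta q c' ->
  scalar_order delta (p + q) (fun j b => c j b * c' j b).
Proof.
move=> [N N0 H] [M M0 K]; exists (2 * N * M) => [|j]; first by rewrite !mulr_ge0.
have -> : 2 * N * M * delta j `^ (p + q)
    = 2 * (N * delta j `^ p) * (M * delta j `^ q).
  by rewrite (scale01_powRD j p)//; ring.
exact: (@pair_bound_scale _ R).
Qed.

Lemma of_order_unit : of_order delta 0 (fun _ _ => rs_unit S).
Proof.
split => [j b|]; first exact: sector_unit.
exists 1 => // j a ag; apply: pair_bound_diag => //.
have [->|/eqP a0] := eqVneq a 0.
  by rewrite rs_unit0 rs_one_norm subrr powRr0 mulr1.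
by rewrite rs_unit_other// normr0 mulr_ge0 ?powR_ge0.
Qed.

Lemma of_order_scalar p c : scalar_order delta p c ->
  of_order delta p (fun j b => c j b *: rs_unit S).
Proof.
by move=> hc; rewrite -[p]addr0; apply: of_order_scale hc of_order_unit.
Qed.

Lemma of_order_coef p u : of_order delta p u ->
  scalar_order delta p (fun j b => rs_coef (u j b)).
Proof.
move=> [_ [N N0 H]]; exists N => // j; have := H j 0 gamma_gt0.
rewrite subr0 => -[h1 h2 h3]; split; rewrite -?rs_coefB rs_coef_norm//.
Qed.

Lemma of_order_trunc p u : of_order delta p u ->
  of_order delta p (fun j b => dtrunc gamma (u j b)).
Proof.
move=> hu; apply: of_order_ext (hu) => [j b|j b a ag].
  exact: sector_trunc (hu.1 j b).
exact: dtrunc_lt.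
Qed.

(** Degrees in the sector are nonnegative, so a part of degree at least [gamma] in either factor
    contributes only from [gamma] on. What remains is a sum over the finitely many degrees in
    [degs S gamma]. *)
Lemma star_compE (x y : rs_type S) a : sector_set V x -> sector_set V y ->
  a < gamma -> star x y a
    = \sum_(ab <- [seq (a, b) | a <- degs S gamma, b <- degs S gamma])
        star (dinj (x ab.1)) (dinj (y ab.2)) a.
Proof.
move=> Vx Vy ag; rewrite big_allpairs /=.
have E (z : rs_type S) : z = dtrunc gamma z + (z - dtrunc gamma z).
  by rewrite addrC subrK.
have high (z z' : rs_type S) : sector_set V z -> sector_set V z' ->
    dtrunc gamma z = 0 -> star z z' a = 0.
  move=> Vz Vz' z0.
  have big0 (t t' : rs_type S) r r' : t = \sum_(i <- r) dinj (t i) ->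
      t' = \sum_(i <- r') dinj (t' i) ->
      (forall i i', i \in r -> i' \in r' -> a != i + i') -> star t t' a = 0.
    move=> -> -> h; rewrite star_suml dcomp_sum big_seq big1// => i ir.
    rewrite star_sumr dcomp_sum big_seq big1// => i' ir'.
    by apply: pr_homogeneous; apply: h.
  have supp (t : rs_type S) : t = \sum_(i <- finmap.enum_fset (fset_set [set i | t i != 0])) dinj (t i).
    apply: dsum_decomp => [|i ti]; first exact: finmap.fset_uniq.
    by rewrite in_fset_set ?inE//; exact: dsum_finite.
  apply: (big0 _ _ _ _ (supp z) (supp z')) => i i'.
  rewrite !in_fset_set; [|exact: dsum_finite|exact: dsum_finite].
  rewrite !inE /= => zi zi'.
  have ig : gamma <= i.
    rewrite leNgt; apply: contraNN zi => ig.
    by have := congr1 (fun w : rs_type S => w i) z0; rewrite dtrunc_lt// => ->.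
  have i'0 : 0 <= i' by rewrite leNgt; apply: contraNN zi' => i'0; rewrite (sector_neg Vz' i'0).
  by apply/eqP => aE; move: ag; rewrite aE ltNge (le_trans ig)// lerDl.
have tr0 (z : rs_type S) : dtrunc gamma (z - dtrunc gamma z) = 0.
  apply: dsumP => i; have [ig|ig] := ltP i gamma; last by rewrite dtrunc_ge.
  by rewrite dtrunc_lt// dcompB dtrunc_lt// subrr.
have Vt (z : rs_type S) : sector_set V z -> sector_set V (z - dtrunc gamma z).
  by move=> Vz; apply: sectorB => //; exact: sector_trunc.
rewrite {1}(E x) starDl dcompD (high (x - _) y)// ?addr0; last exact: Vt.
rewrite {1}(E y) starDr dcompD (pr_comm star _ (y - _)) (high (y - _))//; last 2 first.
- exact: Vt.
- exact: sector_trunc.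
rewrite addr0 (dtrunc_decomp _ Vx) (dtrunc_decomp _ Vy) star_suml dcomp_sum.
by apply: eq_bigr => i _; rewrite star_sumr dcomp_sum.
Qed.

(** In degree [a] only pairs of degrees with a' + b' = a count, and for these the exponents p - a'
    and q - b' add up to p + q - a. *)
Lemma of_order_star p q u v : of_order delta p u -> of_order delta q v ->
  of_order delta (p + q) (fun j b => star (u j b) (v j b)).
Proof.
move=> [hu [N N0 H]] [hv [M M0 K]]; split => [j b|]; first exact: V_star.
pose C ab := projT1 (cid2 (star_comp_bounded star ab.1 ab.2)).
have C0 ab : 0 <= C ab by rewrite /C; case: cid2.
have HC ab (x : rs_space S ab.1) (y : rs_space S ab.2) :
    `|star (dinj x) (dinj y) (ab.1 + ab.2)| <= C ab * `|x| * `|y|.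
  by rewrite /C; case: cid2 => C' ? /= h; exact: h.
exists (\sum_(ab <- [seq (a, b) | a <- degs S gamma, b <- degs S gamma]) 2 * C ab * N * M).
  by apply: sumr_ge0 => ab _; rewrite !mulr_ge0.
move=> j a ag; rewrite !star_compE// mulr_suml.
apply: pair_bound_sum => // _ /allpairsP[[a' b'] /= [/mem_degs[_ _ a'g] /mem_degs[_ _ b'g] ->]].
have [aE|/eqP aE] := eqVneq a (a' + b'); last first.
  rewrite !pr_homogeneous ?(introN eqP)//; apply: pair_bound0 => //.
  by rewrite !mulr_ge0 ?powR_ge0.
rewrite aE; have -> : 2 * C (a', b') * N * M * delta j `^ (p + q - (a' + b')) =
    2 * C (a', b') * (N * delta j `^ (p - a')) * (M * delta j `^ (q - b')).
  by rewrite opprD addrACA (scale01_powRD j (p - a'))//; ring.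
apply: (@pair_bound_bilinear R _ _ _
  (fun x y => star (dinj x) (dinj y) (a' + b')) _ _ _ _ _ _ _ _ (eps_ge0 j) (C0 _)).
- by move=> x y z; rewrite -[- y]scaleN1r dinjD dinjZ starDl dcompD starZl dcompZ scaleN1r.
- by move=> x y z; rewrite -[- z]scaleN1r dinjD dinjZ starDr dcompD starZr dcompZ scaleN1r.
- exact: HC (a', b').
- exact: H.
- exact: K.
Qed.

Lemma of_order_star_eq r p q u v : p + q = r -> of_order delta p u ->
  of_order delta q v -> of_order delta r (fun j b => star (u j b) (v j b)).
Proof. by move=> <-; apply: of_order_star. Qed.

(** Order 0 at scale 1 is plain boundedness. A bounded element starting in degree [p] has order [p],
    because [delta ^ (p - a)] is at least 1 when [a >= p]. *)
Lemma of_order_static p u : of_order (fun=> 1) 0 u ->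
  (forall j b a, a < p -> u j b a = 0) -> of_order delta p u.
Proof.
move=> [hu [N N0 H]] u0; split => //; exists N => // j a ag.
have [ap|pa] := ltP a p.
  by rewrite !u0//; apply: pair_bound0; rewrite ?mulr_ge0 ?powR_ge0.
apply: pair_bound_le (H j a ag) => //; rewrite powR1 ler_wpM2l//.
rewrite -[leLHS](powRr0 (delta j)); apply: powR_le1_anti => //.
by rewrite subr_le0.
Qed.

Lemma of_order_star_pow n p (u : J -> bool -> 'I_n -> rs_type S) k :
  (forall i, of_order delta p (fun j b => u j b i)) ->
  of_order delta (p * (mdeg k)%:R) (fun j b => star_pow star (u j b) k).
Proof.
move=> hu; rewrite /star_pow /mdeg.
elim: (index_enum _) => [|i r IH].
  rewrite big_nil mulr0; apply: (of_order_eq _ of_order_unit) => j b.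
  by rewrite big_nil.
rewrite big_cons natrD mulrDr.
apply: (@of_order_eq _ (fun j b => star (iter (k i) (star (u j b i)) (rs_unit S))
    (\big[star/rs_unit S]_(i <- r) iter (k i) (star (u j b i)) (rs_unit S)))) => [j b|].
  by rewrite big_cons.
apply: of_order_star => //; elim: (k i) => [|t IHt] /=.
  by rewrite mulr0; exact: of_order_unit.
by rewrite -natr1 mulrDr mulr1 addrC; apply: of_order_star.
Qed.

End FixedScale.

(** * The structure group and orders *)

Section Transport.
Variable delta : J -> R.
Hypothesis d01 : scale01 delta.
Variable Gam : J -> {linear (rs_type S) -> (rs_type S)}.
Hypothesis Gam_group : forall j, rs_group S (Gam j).
Hypothesis Gam_bound : exists2 C, 0 <= C & forall j a (x : rs_space S a) m,
  rs_index S a -> a < gamma -> m < a ->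
  `|Gam j (dinj x) m| <= C * `|x| * delta j `^ (a - m).
Hypothesis V_regular : regular_sector V star gamma.

Lemma sector_Gam j x : sector_set V x -> sector_set V (Gam j x).
Proof. by move=> Vx; apply: sec_group. Qed.

Lemma Gam_dinj_same j a (x : rs_space S a) : Gam j (dinj x) a = x.
Proof.
have := rs_group_lower (Gam_group j) x (lexx a).
by rewrite dcompB dinj_same => /eqP; rewrite subr_eq0 => /eqP.
Qed.

Lemma Gam_dinj_gt j a (x : rs_space S a) m : a < m -> Gam j (dinj x) m = 0.
Proof.
move=> am; have := rs_group_lower (Gam_group j) x (ltW am).
by rewrite dcompB dinj_other ?subr0//; apply/eqP; rewrite gt_eqF.
Qed.

Lemma of_order_Gam_dinj u a : of_order (fun=> 1) 0 u -> a \in degs S gamma ->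
  of_order delta a (fun j b => Gam j (dinj (u j b a))).
Proof.
move=> [hu [N N0 H]] /mem_degs[Sa a0 ag]; have [C C0 HC] := Gam_bound.
split => [j b|]; first by apply: sector_Gam; apply: sector_dinj; exact: hu.
(* [C] accounts for the degrees below [a], and 1 for degree [a] itself, where [Gam] acts as the
   identity. *)
exists ((C + 1) * N) => [|j m mg]; first by rewrite mulr_ge0// addr_ge0.
have Hu : pair_bound N (eps j) (u j true a) (u j false a).
  by have := H j a ag; rewrite powR1 mulr1.
have [ma|am|->] := ltgtP m a.
- rewrite mulrAC; apply: (@pair_bound_le _ _ (C * delta j `^ (a - m) * N)) => //.
    by rewrite ler_wpM2r// ler_wpM2r ?powR_ge0// lerDl.
  apply: (@pair_bound_linear R _ _ (fun x : rs_space S a => Gam j (dinj x) m)) => //.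
  + by rewrite mulr_ge0 ?powR_ge0.
  + by move=> x y; rewrite -[- y]scaleN1r dinjD dinjZ linearD linearZ /= scaleN1r.
  + by move=> x; rewrite mulrAC; apply: HC.
- by rewrite !Gam_dinj_gt//; apply: pair_bound0; rewrite ?mulr_ge0 ?powR_ge0 ?addr_ge0.
- rewrite !Gam_dinj_same subrr powRr0 mulr1; apply: pair_bound_le Hu => //.
  by rewrite mulrDl mul1r lerDr mulr_ge0.
Qed.

Lemma Gam_trunc j x : sector_set V x ->
  Gam j (dtrunc gamma x) = \sum_(a <- degs S gamma) Gam j (dinj (x a)).
Proof. by move=> Vx; rewrite (dtrunc_decomp _ Vx) linear_sum. Qed.

Lemma of_order_Gam_static p u : of_order (fun=> 1) 0 u ->
  (forall j b a, a < p -> u j b a = 0) ->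
  of_order delta p (fun j b => Gam j (dtrunc gamma (u j b))).
Proof.
move=> hu u0.
rewrite (_ : (fun _ _ => _) =
    (fun j b => \sum_(a <- degs S gamma) Gam j (dinj (u j b a)))); last first.
  by apply/funext => j; apply/funext => b; rewrite Gam_trunc//; exact: hu.1.
apply: of_order_sum => // a aS; have [ap|pa] := ltP a p; last first.
  by apply: of_order_weaken pa _ => //; exact: of_order_Gam_dinj.
rewrite (_ : (fun _ _ => _) = (fun _ _ => 0)); first exact: of_order0.
by apply/funext => j; apply/funext => b; rewrite u0// dinj0 linear0.
Qed.

(** Both factors are split into homogeneous parts. If the degrees add up to less than [gamma],
    regularity of the sector makes the defect zero. Otherwise truncation removes the product, and
    the product of the two images has order a' + b' >= gamma. *)
Lemma Gam_star_defect u v : of_order (fun=> 1) 0 u -> of_order (fun=> 1) 0 v ->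
  of_order delta gamma (fun j b => Gam j (dtrunc gamma (star (u j b) (v j b)))
    - star (Gam j (dtrunc gamma (u j b))) (Gam j (dtrunc gamma (v j b)))).
Proof.
move=> hu hv.
pose r := [seq (a, b) | a <- degs S gamma, b <- degs S gamma].
pose F (ab : R * R) j b : rs_type S := 
  Gam j (dtrunc gamma (star (dinj (u j b ab.1)) (dinj (v j b ab.2))))
   - star (Gam j (dinj (u j b ab.1))) (Gam j (dinj (v j b ab.2))).
rewrite (_ : (fun _ _ => _) = (fun j b => \sum_(ab <- r) F ab j b)); last first.
  apply/funext => j; apply/funext => b; rewrite sumrB; congr (_ - _).
    rewrite (_ : dtrunc gamma (star _ _) = \sum_(ab <- r) dtrunc gamma
        (star (dinj (u j b ab.1)) (dinj (v j b ab.2)))) ?linear_sum//.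
    rewrite -dtrunc_sum; apply: dsumP => a /=; case: ifP => // ag.
    by rewrite star_compE ?dcomp_sum//; [exact: hu.1|exact: hv.1].
  rewrite !Gam_trunc; [|exact: hv.1|exact: hu.1].
  rewrite star_suml big_allpairs /=; apply: eq_bigr => a _.
  by rewrite star_sumr.
apply: of_order_sum => // _ /allpairsP[[a' b'] /= [a'S b'S ->]].
have Va (w : J -> bool -> rs_type S) j b a : of_order (fun=> 1) 0 w ->
    sec_comp V (w j b a) by move=> [hw _]; exact: hw.
have [abg|abg] := ltP (a' + b') gamma.
  rewrite (_ : F _ = (fun _ _ => 0)); first exact: of_order0.
  apply/funext => j; apply/funext => b; rewrite /F /=.
  rewrite -V_regular//; [|exact: Va|exact: Va].
  rewrite dtrunc_id ?subrr// => c gc; rewrite pr_homogeneous//.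
  by rewrite gt_eqF// (lt_le_trans abg).
apply: (@of_order_eq _ _ (fun j b => 0
    - star (Gam j (dinj (u j b a'))) (Gam j (dinj (v j b b'))))) => [j b|].
  rewrite /F /=; congr (_ - _); rewrite (_ : dtrunc _ _ = 0) ?linear0//.
  apply: dsumP => c; have [cg|gc] := ltP c gamma; last by rewrite dtrunc_ge.
  rewrite dtrunc_lt// pr_homogeneous//.
  by rewrite lt_eqF// (lt_le_trans cg).
apply: of_orderB => //; first exact: of_order0.
apply: of_order_weaken abg _ => //.
by apply: of_order_star => //; exact: of_order_Gam_dinj.
Qed.

(** The first two clauses make the relation stable under [star]: in a product, each defect of order
    [gamma] gets multiplied by a factor of order 0. *)
Definition transported u v := [/\ of_order (fun=> 1) 0 u, of_order delta 0 v &
  of_order delta gamma (fun j b => Gam j (dtrunc gamma (u j b)) - v j b)].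

Lemma transported_unit : transported (fun _ _ => rs_unit S) (fun _ _ => rs_unit S).
Proof.
split; [exact: of_order_unit|exact: of_order_unit|].
apply: (of_order_eq _ (of_order0 _ _)) => j b.
rewrite dtrunc_id ?(rs_group_one (Gam_group j)) ?subrr// => a ga.
by apply: rs_unit_other; apply/eqP; rewrite gt_eqF// (lt_le_trans gamma_gt0).
Qed.

Lemma transported_star u v u' v' : transported u v -> transported u' v' ->
  transported (fun j b => star (u j b) (u' j b)) (fun j b => star (v j b) (v' j b)).
Proof.
move=> [hu hv huv] [hu' hv' huv']; split.
- exact: (of_order_star_eq scale01_one (addr0 0)).
- exact: (of_order_star_eq d01 (addr0 0)).
have hG' : of_order delta 0 (fun j b => Gam j (dtrunc gamma (u' j b))).
  apply: of_order_Gam_static => // j b a a0.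
  exact: (sector_neg (hu'.1 j b)).
(* The defect of the product is the multiplicativity defect of [Gam], plus the change of the first
   factor from its image to [v], plus that of the second factor from its image to [v']. *)
apply: (@of_order_eq _ _ (fun j b =>
   (Gam j (dtrunc gamma (star (u j b) (u' j b)))
    - star (Gam j (dtrunc gamma (u j b))) (Gam j (dtrunc gamma (u' j b))))
   + (star (Gam j (dtrunc gamma (u j b)) - v j b) (Gam j (dtrunc gamma (u' j b)))
      + star (v j b) (Gam j (dtrunc gamma (u' j b)) - v' j b)))) => [j b|].
  by rewrite starBl starBr [X in _ + X]addrA subrK addrA subrK.
apply: of_orderD => //; first exact: Gam_star_defect.
apply: of_orderD => //; first exact: (of_order_star_eq d01 (addr0 gamma)).
exact: (of_order_star_eq d01 (add0r gamma)).
Qed.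

Lemma transported_star_pow n (u v : J -> bool -> 'I_n -> rs_type S) k :
  (forall i, transported (fun j b => u j b i) (fun j b => v j b i)) ->
  transported (fun j b => star_pow star (u j b) k) (fun j b => star_pow star (v j b) k).
Proof.
have ext w w' z z' : (forall j b, w j b = w' j b) -> (forall j b, z j b = z' j b) ->
    transported w z -> transported w' z'.
  move=> ww zz; rewrite (_ : w = w'); last by apply/funext => j; apply/funext => b.
  by rewrite (_ : z = z')//; apply/funext => j; apply/funext => b.
move=> hu; rewrite /star_pow.
elim: (index_enum _) => [|i r IH].
  by apply: (ext _ _ _ _ _ _ transported_unit) => j b; rewrite big_nil.
have H : transported (fun j b => iter (k i) (star (u j b i)) (rs_unit S))
                     (fun j b => iter (k i) (star (v j b i)) (rs_unit S)).
  elim: (k i) => [|t IHt] /=; first exact: transported_unit.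
  exact: transported_star.
by apply: (ext _ _ _ _ _ _ (transported_star H IH)) => j b; rewrite big_cons.
Qed.

(** * Re-expansion of the lift at another point *)

Section Composition.
Variables (n m : nat) (z : R) (fx fy : J -> bool -> 'I_n -> rs_type S).
Hypothesis z_gt0 : 0 < z.
Hypothesis z_le : z <= gamma.
Hypothesis V_gap : forall x : rs_type S, sector_set V x ->
  forall a, 0 < a -> a < z -> x a = 0.
Hypothesis fx_static : forall i, of_order (fun=> 1) 0 (fun j b => fx j b i).
Hypothesis fy_static : forall i, of_order (fun=> 1) 0 (fun j b => fy j b i).
Hypothesis fy_dlt : forall j b i, dlt gamma (fy j b i).
Hypothesis fxy : forall i,
  of_order delta gamma (fun j b => fx j b i - Gam j (fy j b i)).

Let tx j b i := rs_tilde (fx j b i).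
Let ty j b i := rs_tilde (fy j b i).

Definition coef_diff j b : 'rV[R]_n :=
  \row_i (rs_coef (fx j b i) - rs_coef (fy j b i)).

Lemma tilde_low (x : rs_type S) a : sector_set V x -> a < z -> rs_tilde x a = 0.
Proof.
move=> Vx az; have [a0|a0|->] := ltgtP a 0; last exact: rs_tilde0.
  by rewrite (sector_neg (sector_tilde Vx)).
by rewrite rs_tilde_other ?V_gap//; apply/eqP; rewrite gt_eqF.
Qed.

Lemma tilde_static u : of_order (fun=> 1) 0 u ->
  of_order (fun=> 1) 0 (fun j b => rs_tilde (u j b)).
Proof.
move=> hu; apply: (of_orderB scale01_one) => //.
by apply: (of_order_scalar scale01_one); exact: (of_order_coef).
Qed.

Lemma Gam_tilde j b i : Gam j (dtrunc gamma (ty j b i))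
  = Gam j (fy j b i) - rs_coef (fy j b i) *: rs_unit S.
Proof.
rewrite dtrunc_id; last first.
  move=> a ga; rewrite rs_tilde_other ?(fy_dlt _ _ _ ga)//.
  by apply/eqP; rewrite gt_eqF// (lt_le_trans gamma_gt0).
by rewrite /ty /rs_tilde linearB linearZ /= (rs_group_one (Gam_group j)).
Qed.

(** The difference is the coefficient of the unit in (f(x) - Gam f(y)) + Gam f'(y). The first
    summand has order [gamma >= z], the second order [z], since f'(y) has no component below degree
    [z]. *)
Lemma coef_diff_order i : scalar_order delta z (fun j b => coef_diff j b 0 i).
Proof.
have hG : of_order delta z (fun j b => Gam j (dtrunc gamma (ty j b i))).
  apply: of_order_Gam_static => [|j b a az]; first exact: tilde_static.
  by apply: tilde_low => //; exact: ((fy_static i).1 j b).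
have hs : of_order delta z (fun j b => (fx j b i - Gam j (fy j b i))
     + Gam j (dtrunc gamma (ty j b i))).
  by apply: of_orderD => //; apply: of_order_weaken (fxy i).
have [N N0 H] := of_order_coef hs; exists N => // j.
have E b : coef_diff j b 0 i = rs_coef ((fx j b i - Gam j (fy j b i))
     + Gam j (dtrunc gamma (ty j b i))).
  rewrite mxE Gam_tilde addrA subrK rs_coefB; congr (_ - _).
  by apply/esym/rs_coefP; rewrite dcompZ rs_unit0.
by rewrite !E; exact: H.
Qed.

Lemma tilde_order i : of_order delta z (fun j b => tx j b i).
Proof.
apply: of_order_static => // [|j b a az]; first exact: tilde_static.
by apply: tilde_low => //; exact: ((fx_static i).1 j b).
Qed.

Lemma tilde_transported i : transported (fun j b => ty j b i)
  (fun j b => tx j b i + coef_diff j b 0 i *: rs_unit S).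
Proof.
split; first exact: tilde_static.
  apply: of_orderD => //; first exact: (of_order_weaken d01 (ltW z_gt0) (tilde_order i)).
  apply: of_order_scalar => //; apply: (scalar_order_weaken d01 (ltW z_gt0)).
  exact: coef_diff_order.
apply: (@of_order_eq _ _ (fun j b => 0 - (fx j b i - Gam j (fy j b i)))) => [j b|].
  rewrite Gam_tilde /tx /rs_tilde mxE scalerBl addrA subrK.
  by rewrite sub0r !opprB addrA subrK.
by apply: of_orderB => //; exact: of_order0.
Qed.

Variables Dx Dy : {ffun 'I_n -> nat} -> J -> bool -> R.
Hypothesis Dy_order : forall k, (mdeg k <= m)%N -> scalar_order delta 0 (Dy k).
Hypothesis Dx_taylor : forall l, (mdeg l <= m)%N ->
  scalar_order delta (gamma - z * (mdeg l)%:R) (fun j b => Dx l j b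
    - \sum_(k <- midx n (m - mdeg l)) Dy (madd l k) j b * mono k (coef_diff j b)).

(** [Dx] and [Dy] stand for the derivatives of F at the two points; the regularity of F enters only
    through [Dy_order] and [Dx_taylor], so that diagonal and Lipschitz cases are treated together.
    Below [gamma] the difference equals [H - G]: [H] collects the Taylor remainders, and [G] the
    errors in replacing the image of f'(y)^k by (f'(x) + c 1)^k. *)
Lemma of_order_composition : of_order delta gamma (fun j b =>
    \sum_(k <- midx n m) (Dx k j b / (mfact k)%:R) *: dtrunc gamma (star_pow star (tx j b) k)
  - Gam j (\sum_(k <- midx n m)
       (Dy k j b / (mfact k)%:R) *: dtrunc gamma (star_pow star (ty j b) k))).
Proof.
have cst_order (p : R) (c : J -> bool -> R) (k : R) : scalar_order delta p c ->
    scalar_order delta p (fun j b => c j b * k).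
  by move=> hc; rewrite -[p]addr0; apply: scalar_orderM => //; exact: scalar_order_cst.
pose G j b := \sum_(k <- midx n m) (Dy k j b / (mfact k)%:R) *:
   (Gam j (dtrunc gamma (star_pow star (ty j b) k))
   - star_pow star (fun i => tx j b i + coef_diff j b 0 i *: rs_unit S) k).
have hG : of_order delta gamma G.
  apply: of_order_sum => // k; rewrite mem_midx => km.
  apply: (@of_order_weaken _ _ (0 + gamma)) => //; first by rewrite add0r.
  apply: of_order_scale => //; first exact/cst_order/Dy_order.
  by have [] := transported_star_pow k tilde_transported.
pose H j b := \sum_(l <- midx n m) ((Dx l j b
    - \sum_(k <- midx n (m - mdeg l)) Dy (madd l k) j b * mono k (coef_diff j b))
     / (mfact l)%:R) *: star_pow star (tx j b) l.
have hH : of_order delta gamma H.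
  apply: of_order_sum => // l; rewrite mem_midx => lm.
  apply: (@of_order_weaken _ _ (gamma - z * (mdeg l)%:R + z * (mdeg l)%:R)) => //.
    by rewrite subrK.
  apply: of_order_scale => //; first exact/cst_order/Dx_taylor.
  exact/of_order_star_pow/tilde_order.
have VP (w : J -> bool -> 'I_n -> rs_type S) k j b :
    (forall i, of_order (fun=> 1) 0 (fun j b => w j b i)) ->
    sector_set V (star_pow star (w j b) k).
  by move=> hw; exact: ((of_order_star_pow scale01_one k hw).1 j b).
apply: (@of_order_ext _ _ (fun j b => H j b - G j b)).
- move=> j b; apply: sectorB.
    apply: sector_sum => k; apply: sectorZ; apply: sector_trunc.
    by apply: VP => i; exact: tilde_static.
  apply: sector_Gam; apply: sector_sum => k; apply: sectorZ; apply: sector_trunc.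
  by apply: VP => i; exact: tilde_static.
- move=> j b a ag; rewrite !dcompB linear_sum.
  have -> : \sum_(k <- midx n m) Gam j ((Dy k j b / (mfact k)%:R) *:
      dtrunc gamma (star_pow star (ty j b) k)) = G j b
     + \sum_(k <- midx n m) (Dy k j b / (mfact k)%:R) *:
      star_pow star (fun i => tx j b i + coef_diff j b 0 i *: rs_unit S) k.
    rewrite -big_split; apply: eq_bigr => k _ /=.
    by rewrite linearZ /= -scalerDr subrK.
  rewrite (@star_taylor _ _ star n m (fun k => Dy k j b) (tx j b)) dcompD opprD [in RHS]addrC.
  rewrite [LHS]addrCA; congr (_ + _).
  rewrite !dcomp_sum -sumrB; apply: eq_bigr => l _.
  by rewrite !dcompZ dtrunc_lt// mulrBl scalerBl.
exact: of_orderB.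
Qed.

Lemma of_order_lift_static : (forall k, (mdeg k <= m)%N -> scalar_order (fun=> 1) 0 (Dx k)) ->
  of_order (fun=> 1) 0 (fun j b =>
    \sum_(k <- midx n m) (Dx k j b / (mfact k)%:R) *: dtrunc gamma (star_pow star (tx j b) k)).
Proof.
move=> hD; apply: of_order_sum => // k; rewrite mem_midx => km.
apply: (of_order_weaken scale01_one (_ : 0 <= 0 + 0 + 0)); first by rewrite !addr0.
apply: (of_order_scale scale01_one).
  apply: (scalar_orderM scale01_one); first exact: hD.
  exact: (scalar_order_cst scale01_one).
apply: of_order_trunc.
have := of_order_star_pow scale01_one k (fun i => tilde_static (fx_static i)).
by rewrite mul0r.
Qed.

End Composition.
End Transport.
End Orders.

(** * Orders of derivatives and Taylor remainders *)

Section ScalarOrders.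
Variables (R : realType) (n : nat) (J : Type) (eps delta : J -> R).
Hypothesis eps_ge0 : forall j, 0 <= eps j.
Hypothesis d01 : scale01 delta.
Implicit Types (f : 'rV[R]_n -> R) (b c : J -> bool -> 'rV[R]_n).

Definition row_order p b := exists2 N, 0 <= N &
  forall j, pair_bound (N * delta j `^ p) (eps j) (b j true) (b j false).

Lemma row_order_coord p b : (forall i, scalar_order eps delta p (fun j t => b j t 0 i)) ->
  row_order p b.
Proof.
move=> /fin_all_exists2[N N0 H]; have S0 : 0 <= \sum_i N i by exact: sumr_ge0.
have NS i : N i <= \sum_i N i by rewrite (bigD1 i)//= lerDl sumr_ge0.
exists (\sum_i N i) => // j.
have P0 : 0 <= (\sum_i N i) * delta j `^ p by rewrite mulr_ge0 ?powR_ge0.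
split; (apply: row_norm_le; first by rewrite ?(mulr_ge0 P0)) => i.
- by have [h _ _] := H i j; rewrite (le_trans h)// ler_wpM2r ?powR_ge0.
- by have [_ h _] := H i j; rewrite (le_trans h)// ler_wpM2r ?powR_ge0.
- have [_ _ h] := H i j; rewrite !mxE (le_trans h)// ler_wpM2r//.
  by rewrite ler_wpM2r ?powR_ge0.
Qed.

Lemma scalar_order_diag f b : continuous f -> (forall j, b j true = b j false) ->
  row_order 0 b -> scalar_order eps delta 0 (fun j t => f (b j t)).
Proof.
move=> cf bE [N N0 H]; have [C C0 HC] := continuous_ball_bounded N cf.
exists C => // j; rewrite bE powRr0 mulr1; apply: pair_bound_diag => //.
by apply: HC; have [_ + _] := H j; rewrite powRr0 mulr1.
Qed.

Lemma scalar_order_lipschitz f b : Cm 1 f -> row_order 0 b ->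
  scalar_order eps delta 0 (fun j t => f (b j t)).
Proof.
move=> Cf [N N0 H]; have [C C0 HC] := continuous_ball_bounded N (Cm_continuous Cf).
have [_ /(_ _ (mdeg_zero n) N)[D D0]] := Cm_holder_class Cf.
rewrite partial_multi0 => HD.
exists (C + D * N) => [|j]; first by rewrite addr_ge0 ?mulr_ge0.
have := H j; rewrite powRr0 !mulr1 => -[b1 b2 b3]; split.
- by rewrite (le_trans (HC _ b1))// lerDl mulr_ge0.
- by rewrite (le_trans (HC _ b2))// lerDl mulr_ge0.
rewrite (le_trans (HD _ _ b1 b2))// powRr1// mulrDl ler_wpDl ?mulr_ge0//.
by rewrite -mulrA ler_wpM2l.
Qed.

Lemma scale_pow_bound (N z q x : R) j : 0 <= N -> 0 <= q -> 0 <= x ->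
  x <= N * delta j `^ z -> x `^ q <= N `^ q * delta j `^ (z * q).
Proof.
move=> N0 q0 x0 xN; have /andP[dj0 _] := d01 j.
apply: le_trans (_ : (N * delta j `^ z) `^ q <= _).
  by apply: ge0_ler_powR; rewrite ?nnegrE ?mulr_ge0 ?powR_ge0.
by rewrite powRM ?powR_ge0// powRrM.
Qed.

Lemma taylor_rem_order_diag m theta z f b c : 0 < theta -> 0 < z ->
  holder_class m theta f ->
  (forall j, b j true = b j false) -> (forall j, c j true = c j false) ->
  row_order 0 b -> row_order z c ->
  scalar_order eps delta (z * (m%:R + theta))
    (fun j t => taylor_rem m f (b j t) (c j t)).
Proof.
move=> t0 z0 hf bE cE [N N0 HN] [M M0 HM].
have [C C0 HC] := rem_bound t0 hf (N + M).
exists (C * M `^ (m%:R + theta)) => [|j]; first by rewrite mulr_ge0 ?powR_ge0.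
rewrite bE cE; apply: pair_bound_diag => //.
have [_ bN _] := HN j; rewrite powRr0 mulr1 in bN.
have [_ cM _] := HM j.
have dz1 : delta j `^ z <= 1.
  by rewrite -(powRr0 (delta j)); apply: (powR_le1_anti (d01 j)); exact: ltW.
have cM' : `|c j false| <= M by rewrite (le_trans cM)// ler_piMr.
rewrite (le_trans (HC _ _ _ _))//.
- by rewrite (le_trans bN)// lerDl.
- by rewrite (le_trans cM')// lerDr.
rewrite -mulrA ler_wpM2l//; apply: scale_pow_bound => //.
by rewrite addr_ge0// ltW.
Qed.

Lemma taylor_rem_order_lipschitz m theta z f b c : 0 < theta -> theta <= 1 -> 0 < z ->
  holder_class m.+1 theta f ->
  row_order 0 b -> row_order z c ->
  scalar_order eps delta (z * (m%:R + theta))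
    (fun j t => taylor_rem m f (b j t) (c j t)).
Proof.
move=> t0 t1 z0 hf [N N0 HN] [M M0 HM].
have [C C0 HC] := rem_bound ltr01 (Cm_holder_class hf.1) (N + M).
have [D D0 HD] := rem_lipschitz t0 hf (N + M).
have q0 : 0 <= m%:R + theta :> R by rewrite addr_ge0// ltW.
pose A := M `^ (m%:R + 1); pose B := M `^ (m%:R + theta).
have A0 : 0 <= A by exact: powR_ge0.
have B0 : 0 <= B by exact: powR_ge0.
(* [C * A] bounds the two remainders, by [rem_bound] with exponent m + 1, which is at least m +
   theta. In their difference [D * A] comes from the change of increment and [D * B * N] from the
   change of base point, by [rem_lipschitz] with [rho = M * delta ^ z]. *)
exists (C * A + D * (A + B * N)) => [|j]; first by rewrite !(addr_ge0, mulr_ge0).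
have [b1 b2 b3] := HN j; rewrite powRr0 mulr1 in b1 b2 b3.
have [c1 c2 c3] := HM j.
have dz1 : delta j `^ z <= 1.
  by rewrite -(powRr0 (delta j)); apply: (powR_le1_anti (d01 j)); exact: ltW.
have rM : M * delta j `^ z <= M by rewrite ler_piMr.
set X := delta j `^ (z * (m%:R + theta)).
have X0 : 0 <= X by exact: powR_ge0.
have DX : delta j `^ (z * (m%:R + 1)) <= X.
  apply: (powR_le1_anti (d01 j)); rewrite ler_wpM2l ?(ltW z0)//.
  by rewrite lerD2l.
have bnd t : `|b j t| <= N -> `|c j t| <= M * delta j `^ z ->
    `|taylor_rem m f (b j t) (c j t)| <= (C * A + D * (A + B * N)) * X.
  move=> bN cM; apply: (le_trans (HC _ _ _ _)).
  - by rewrite (le_trans bN)// lerDl.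
  - by rewrite (le_trans cM)// (le_trans rM)// lerDr.
  rewrite mulrDl; apply: (@le_trans _ _ (C * A * X)); last first.
    by rewrite lerDl !(mulr_ge0, addr_ge0).
  rewrite -mulrA ler_wpM2l//.
  apply: (le_trans (scale_pow_bound M0 _ _ cM)) => //.
  by rewrite ler_wpM2l.
split; [exact: bnd|exact: bnd|].
have := HD (b j true) (b j false) (c j true) (c j false) (M * delta j `^ z).
rewrite c1 c2 !(le_trans b1, le_trans b2) ?lerDl//.
rewrite (le_trans rM) ?lerDr// => /(_ isT isT isT isT isT)/le_trans; apply.
rewrite -[leRHS]mulrA mulrDl; apply: ler_wpDl; first by rewrite !mulr_ge0.
rewrite -[leRHS]mulrA ler_wpM2l// mulrDl; apply: lerD.
  apply: (@le_trans _ _ ((M * delta j `^ z) ^+ m * (M * delta j `^ z * eps j))).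
    by rewrite ler_wpM2l// exprn_ge0// mulr_ge0// powR_ge0.
  rewrite mulrA -exprSr -powR_mulrn ?mulr_ge0 ?powR_ge0// powRM ?powR_ge0//.
  by rewrite -powRrM -natr1 -/A -mulrA ler_wpM2l// ler_wpM2r.
rewrite powRM ?powR_ge0// -powRrM -/B -/X -!mulrA ler_wpM2l//.
by rewrite [leRHS]mulrCA ler_wpM2l.
Qed.

End ScalarOrders.

(** * The lift *)

Lemma seq_has_min (R : realType) (s : seq R) : s != [::] ->
  exists2 x, x \in s & forall y, y \in s -> x <= y.
Proof.
elim: s => [//|x s IH] _; have [->|/IH[y ys ymin]] := eqVneq s [::].
  by exists x; rewrite ?mem_head// => y; rewrite inE => /eqP ->.
exists (Num.min x y) => [|t].
  by rewrite /Num.min; case: ifP; rewrite inE ?eqxx ?ys ?orbT.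
by rewrite inE ge_min => /predU1P[->|/ymin ->]; rewrite ?lexx ?orbT.
Qed.

Section Gap.
Variables (R : realType) (S : regularity_structure R) (V : function_like_sector S).
Variable gamma : R.
Hypothesis gamma_gt0 : 0 < gamma.

Lemma sector_comp_neq0 (x : rs_type S) a : sector_set V x -> x a != 0 ->
  sec_comp V (b := a) <> [set 0].
Proof. by move=> Vx xa Va; have := Vx a; rewrite Va => /= xa0; rewrite xa0 eqxx in xa. Qed.

(* With [z] the minimum of [zeta] and [gamma], or [gamma] if there is no [zeta]. *)
Lemma sector_gap : exists z : R, [/\ 0 < z, z <= gamma,
    gamma <= z * Num.max (zeta_ratio V gamma) 1 &
    forall x : rs_type S, sector_set V x -> forall a, 0 < a -> a < z -> x a = 0].
Proof.
rewrite /zeta_ratio; case: pselect => [h|noz].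
  case: (cid h) => z0 /= [z00 _ z0min]; exists (Num.min z0 gamma).
  split; rewrite ?lt_min ?z00 ?ge_min ?lexx ?orbT//.
    (* If zeta < gamma, then z = zeta and z (gamma / zeta) = gamma. Otherwise z = gamma, and the
       lower bound 1 in the maximum suffices. *)
    rewrite /Num.min; case: ifPn => [zg|_].
      apply: (@le_trans _ _ (z0 * (gamma / z0))).
        by rewrite mulrCA divff ?mulr1// gt_eqF.
      by rewrite ler_wpM2l ?(ltW z00)// le_max lexx.
    by rewrite -[leLHS]mulr1 ler_wpM2l ?(ltW gamma_gt0)// le_max lexx orbT.
  move=> x Vx a a0; rewrite lt_min => /andP[az _]; apply/eqP.
  apply: contraTT az => xa; rewrite -leNgt; apply: z0min => //.
  exact: sector_comp_neq0 Vx xa.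
exists gamma; split => //.
  by rewrite -[leLHS]mulr1 ler_wpM2l ?(ltW gamma_gt0)// le_max lexx orbT.
move=> x Vx a a0 ag; apply/eqP; apply: contrapT => /negP xa; apply: noz.
(* If a degree between 0 and [gamma] occurred in V, there would be a least one among the finitely
   many, and it would be a zeta. *)
pose s := [seq b <- degs S gamma | (0 < b) && `[< sec_comp V (b := b) <> [set 0] >]].
have as_ : a \in s.
  rewrite mem_filter a0 (sector_degs Vx ag xa) andbT.
  by apply/asboolP; exact: sector_comp_neq0 Vx xa.
have [|z] := @seq_has_min _ s; first by apply: contraTneq as_ => ->.
rewrite mem_filter => /andP[/andP[z0 /asboolP zV] /mem_degs[_ _ zg]] zmin.
exists z; split => // b b0 bV; have [bg|gb] := ltP b gamma; last first.
  by rewrite ltW// (lt_le_trans zg).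
apply: zmin; rewrite mem_filter b0 /=; apply/andP; split; first exact/asboolP.
apply/mem_degs; split => //; last exact: ltW.
apply: contrapT => Sb; apply: bV; apply/seteqP; split => y /=.
  by move=> _; apply: rs_space_trivial.
by move=> ->; have [] := sec_subspace V b.
Qed.

End Gap.

Section TruncatedLift.
Variables (R : realType) (S : regularity_structure R) (star : product S).
Variables (V : function_like_sector S) (gamma z : R).
Hypothesis V_star : product_invariant V star.
Hypothesis gamma_gt0 : 0 < gamma.
Hypothesis z_gt0 : 0 < z.
Hypothesis V_gap : forall x : rs_type S,
  sector_set V x -> forall a, 0 < a -> a < z -> x a = 0.

(** A counterpart of [of_order] for a single element, which records only the lowest degree and no
    size. *)
Definition low p (x : rs_type S) := sector_set V x /\
  forall a, a < gamma -> a < p -> x a = 0.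

Lemma low_star p q x y : low p x -> low q y -> low (p + q) (star x y).
Proof.
move=> [Vx hx] [Vy hy]; split => [|a ag apq]; first exact: V_star.
rewrite (star_compE star Vx Vy ag) big_seq big1// => _
  /allpairsP[[a' b'] /= [/mem_degs[_ _ a'g] /mem_degs[_ _ b'g] ->]].
have [aE|/eqP aE] := eqVneq a (a' + b'); last first.
  by rewrite pr_homogeneous// (introN eqP).
have [a'p|pa'] := ltP a' p; first by rewrite hx// dinj0 star0l.
have [b'q|qb'] := ltP b' q; first by rewrite hy// dinj0 star0r.
by move: apq; rewrite aE ltNge lerD.
Qed.

Lemma low_unit : low 0 (rs_unit S).
Proof.
split=> [|a _ a0]; first exact: sector_unit.
exact: (sector_neg (sector_unit V) a0).
Qed.

Lemma low_star_pow n (u : 'I_n -> rs_type S) k : (forall i, low z (u i)) ->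
  low (z * (mdeg k)%:R) (star_pow star u k).
Proof.
move=> hu; rewrite /star_pow /mdeg; elim: (index_enum _) => [|i r IH].
  by rewrite !big_nil mulr0; exact: low_unit.
rewrite !big_cons natrD mulrDr; apply: low_star => //.
elim: (k i) => [|t IHt] /=; first by rewrite mulr0; exact: low_unit.
by rewrite -natr1 mulrDr mulr1 addrC; apply: low_star.
Qed.

(** A term with |k| > m starts in degree z |k| >= z (m + 1) >= gamma, so it is removed by the
    truncation. *)
Lemma Fhat_truncE n (F : 'rV[R]_n -> R) m (u : 'I_n -> rs_type S) :
  (forall i, sector_set V (u i)) -> gamma <= z * m.+1%:R ->
  Fhat_trunc star F gamma u = \sum_(k <- midx n m)
    (partial_multi k F (\row_i rs_coef (u i)) / (mfact k)%:R) *: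
      dtrunc gamma (star_pow star (fun i => rs_tilde (u i)) k).
Proof.
move=> Vu gm; rewrite /Fhat_trunc (fsbigE (midx n m)) ?midx_uniq//.
  rewrite (eq_bigl xpredT) => [|k]; last by rewrite in_setT.
  by apply: eq_bigr => k _; rewrite dtruncZ.
move=> k _; rewrite mem_midx -ltnNge => mk; rewrite dtruncZ.
have lt i : low z (rs_tilde (u i)).
  by split=> [|a _ az]; [exact: sector_tilde|exact: tilde_low (Vu i) az].
have [_ H] := low_star_pow k lt.
rewrite (_ : dtrunc gamma _ = 0) ?scaler0//; apply: dsumP => a.
have [ag|ga] := ltP a gamma; last by rewrite dtrunc_ge.
rewrite dtrunc_lt// H// (lt_le_trans ag)// (le_trans gm)//.
by rewrite ler_wpM2l ?(ltW z_gt0)// ler_nat.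
Qed.

Lemma Fhat_trunc_sector n (F : 'rV[R]_n -> R) m (u : 'I_n -> rs_type S) :
  (forall i, sector_set V (u i)) -> gamma <= z * m.+1%:R ->
  dlt gamma (Fhat_trunc star F gamma u) /\
  sector_set V (Fhat_trunc star F gamma u).
Proof.
move=> Vu gm; rewrite (Fhat_truncE F Vu gm); split => [a ga|].
  by rewrite dcomp_sum big1// => k _; rewrite dcompZ dtrunc_ge// scaler0.
apply: sector_sum => k; apply: sectorZ; apply: sector_trunc.
have lt i : low z (rs_tilde (u i)).
  by split=> [|a _ az]; [exact: sector_tilde|exact: tilde_low (Vu i) az].
exact: (low_star_pow k lt).1.
Qed.

End TruncatedLift.

Section LiftOrders.
Variables (R : realType) (S : regularity_structure R) (star : product S).
Variables (V : function_like_sector S) (gamma z : R).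
Hypothesis V_star : product_invariant V star.
Hypothesis gamma_gt0 : 0 < gamma.
Hypothesis V_regular : regular_sector V star gamma.
Hypothesis z_gt0 : 0 < z.
Hypothesis z_le : z <= gamma.
Hypothesis V_gap : forall x : rs_type S,
  sector_set V x -> forall a, 0 < a -> a < z -> x a = 0.
Variables (n : nat) (F : 'rV[R]_n -> R) (m : nat) (theta : R).
Hypothesis theta_gt0 : 0 < theta.
Hypothesis theta_le1 : theta <= 1.
Hypothesis gamma_le : gamma <= z * (m%:R + theta).
Variables (J : Type) (eps : J -> R).
Hypothesis eps_ge0 : forall j, 0 <= eps j.

Definition diagonal_family (T : Type) (f : J -> bool -> T) := forall j, f j true = f j false.

(* In the diagonal case the differences vanish, and [F] needs no additional
   derivative. *)
Definition lift_regular (fx : J -> bool -> 'I_n -> rs_type S) :=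
  holder_class m theta F /\ diagonal_family fx \/ holder_class m.+1 theta F.

Lemma gamma_le_succ : gamma <= z * m.+1%:R.
Proof.
by apply: (le_trans gamma_le); rewrite ler_wpM2l ?(ltW z_gt0)// -natr1 lerD2l.
Qed.

Section OneFamily.
Variable fx : J -> bool -> 'I_n -> rs_type S.
Hypothesis fx_regular : lift_regular fx.
Hypothesis fx_static : forall i, of_order V gamma eps (fun=> 1) 0 (fun j b => fx j b i).

Definition coef_row j b : 'rV[R]_n := \row_i rs_coef (fx j b i).

Lemma coef_row_static : row_order eps (fun=> 1) 0 coef_row.
Proof.
apply: row_order_coord => // i; have [N N0 H] := of_order_coef gamma_gt0 (fx_static i).
by exists N => // j; rewrite !mxE.
Qed.

Lemma partial_coef_order delta k : (mdeg k <= m)%N ->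
  scalar_order eps delta 0 (fun j b => partial_multi k F (coef_row j b)).
Proof.
move=> km; have [N N0 HN] := coef_row_static.
have ho : row_order eps delta 0 coef_row.
  by exists N => // j; have := HN j; rewrite !powRr0.
case: fx_regular => [[[CF _] dx]|[CF _]].
  apply: scalar_order_diag => //; last first.
    by move=> j; rewrite /coef_row dx.
  by apply: (@Cm_continuous _ _ 0); apply: Cm_multi; apply: Cm_le _ CF; rewrite addn0.
apply: scalar_order_lipschitz => //.
by apply: Cm_multi; apply: Cm_le _ CF; rewrite addn1.
Qed.

Lemma lift_static : of_order V gamma eps (fun=> 1) 0
  (fun j b => Fhat_trunc star F gamma (fx j b)).
Proof.
have H := of_order_lift_static V_star gamma_gt0 eps_ge0 fx_static
  (@partial_coef_order (fun=> 1)).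
apply: of_order_eq H => j b.
by rewrite (Fhat_truncE V_star z_gt0 V_gap F _ gamma_le_succ)// => i; exact: (fx_static i).1.
Qed.

End OneFamily.

Variables (delta : J -> R) (Gam : J -> {linear (rs_type S) -> (rs_type S)}).
Hypothesis d01 : scale01 delta.
Hypothesis Gam_group : forall j, rs_group S (Gam j).
Hypothesis Gam_bound : exists2 C : R, 0 <= C & forall j a (x : rs_space S a) k,
  rs_index S a -> a < gamma -> k < a ->
  `|Gam j (dinj x) k| <= C * `|x| * delta j `^ (a - k).
Variables fx fy : J -> bool -> 'I_n -> rs_type S.
Hypothesis fx_regular : lift_regular fx.
Hypothesis fy_regular : lift_regular fy.
Hypothesis fx_static : forall i, of_order V gamma eps (fun=> 1) 0 (fun j b => fx j b i).
Hypothesis fy_static : forall i, of_order V gamma eps (fun=> 1) 0 (fun j b => fy j b i).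
Hypothesis fy_dlt : forall j b i, dlt gamma (fy j b i).
Hypothesis fxy : forall i,
  of_order V gamma eps delta gamma (fun j b => fx j b i - Gam j (fy j b i)).

Lemma lift_order : of_order V gamma eps delta gamma
  (fun j b => Fhat_trunc star F gamma (fx j b)
     - Gam j (Fhat_trunc star F gamma (fy j b))).
Proof.
pose c := coef_diff fx fy.
have hc : row_order eps delta z c.
  apply: row_order_coord => // i.
  exact: (coef_diff_order gamma_gt0 eps_ge0 d01 Gam_group Gam_bound z_le V_gap
    fy_static fy_dlt fxy).
have hy : row_order eps delta 0 (coef_row fy).
  have [N N0 HN] := coef_row_static fy_static.
  by exists N => // j; have := HN j; rewrite !powRr0.
have CF : Cm m F by case: fy_regular => [[[]]|[CF _]] //; exact: Cm_le _ CF.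
have H := of_order_composition V_star gamma_gt0 eps_ge0 d01 Gam_group Gam_bound
  V_regular (m := m) z_gt0 z_le V_gap fx_static fy_static fy_dlt fxy
  (Dx := fun k j b => partial_multi k F (coef_row fx j b))
  (partial_coef_order fy_regular fy_static delta).
apply: of_order_eq (H _) => [j b|l lm].
  by rewrite !(Fhat_truncE V_star z_gt0 V_gap F _ gamma_le_succ)// => i;
    first [exact: (fx_static i).1|exact: (fy_static i).1].
have lE : (mdeg l + (m - mdeg l))%N = m by rewrite subnKC.
(* For the derivatives of F, the left side of [Dx_taylor] is the Taylor remainder of D^l F with base
   point f0(y) and increment [c]. *)
have E : (fun j b => partial_multi l F (coef_row fx j b) -
      \sum_(k <- midx n (m - mdeg l))
         partial_multi (madd l k) F (coef_row fy j b) * mono k (coef_diff fx fy j b))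
    = (fun j b => taylor_rem (m - mdeg l) (partial_multi l F) (coef_row fy j b) (c j b)).
  apply/funext => j; apply/funext => b; rewrite /taylor_rem; congr (_ - _).
    by congr (partial_multi l F _); apply/rowP => i; rewrite !mxE addrC subrK.
  rewrite /taylor big_seq [RHS]big_seq; apply: eq_bigr => k.
  rewrite mem_midx => km; rewrite maddC partial_multiD//.
  by apply: Cm_le _ CF; rewrite addnC -leq_subRL.
(* The remainder has order z (m - |l| + theta) = z (m + theta) - z |l|, which is at least gamma - z
   |l|. *)
rewrite E; apply: (@scalar_order_weaken _ _ _ eps_ge0 _ d01
    (z * ((m - mdeg l)%:R + theta))).
  by rewrite natrB// addrAC mulrBr lerD2r.
have case2 : holder_class m.+1 theta F -> scalar_order eps delta
    (z * ((m - mdeg l)%:R + theta))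
    (fun j b => taylor_rem (m - mdeg l) (partial_multi l F) (coef_row fy j b) (c j b)).
  move=> hF; apply: taylor_rem_order_lipschitz => //.
  by apply: holder_class_multi; rewrite addnS lE.
case: fx_regular => [[_ dx]|//]; case: fy_regular => [[hF dy]|//].
apply: taylor_rem_order_diag => //.
- by apply: holder_class_multi; rewrite lE.
- by move=> j; rewrite /coef_row dy.
- by move=> j; rewrite /c /coef_diff dx dy.
Qed.

End LiftOrders.

(** * Modelled distributions *)

Section ScaledDistance.
Variables (R : realType) (d : nat) (s : scaling d).

Lemma sc_norm_gt0 (x : 'rV[R]_d) : x != 0 -> 0 < sc_norm s x.
Proof.
move=> x0; have [i xi] : exists i, x 0 i != 0.
  apply/not_existsP => h; move/eqP: x0; apply; apply/rowP => i; rewrite mxE.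
  by apply/eqP; apply: contrapT => /negP; exact: h.
rewrite /sc_norm (bigD1 i)//=; apply: ltr_pwDl; first by rewrite powR_gt0 ?normr_gt0.
by apply: sumr_ge0 => j _; exact: powR_ge0.
Qed.

End ScaledDistance.

(** [mod_bounds] is conditional on a test order; since the index set is bounded below, there is
    one. *)
Lemma test_order_exists (R : realType) (S : regularity_structure R) :
  exists r, test_order S r.
Proof.
have [c hc] := rs_index_lbound S.
pose P r := `[< forall l, rs_index S l -> - r%:R < l >].
have exP : exists r, P r.
  exists (Num.bound `|c|); apply/asboolP => l Sl; apply: lt_le_trans (hc l Sl).
  by rewrite ltrNl (le_lt_trans (ler_norm _))// normrN archi_boundP.
exists (ex_minn exP); case: ex_minnP => r /asboolP hr rmin; split => // r' hr'.
by apply: rmin; apply/asboolP.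
Qed.

Lemma Gamma_bound (R : realType) (S : regularity_structure R) d (s : scaling d)
    (M : model S s) gamma (K : set 'rV[R]_d) : 0 < gamma -> compact K ->
  exists2 C : R, 0 <= C & forall x y a (u : rs_space S a) k, K x -> K y ->
    rs_index S a -> a < gamma -> k < a ->
    `|mod_Gamma M x y (dinj u) k| <= C * `|u| * sc_norm s (x - y) `^ (a - k).
Proof.
move=> g0 cK; have [r hr] := test_order_exists S.
have [C HC] := mod_bounds M g0 cK hr.
exists `|C| => // x y a u k Kx Ky Sa ag ka.
have [_ /(_ x y k Kx Ky ka)/le_trans] := HC a u Sa ag; apply.
by rewrite !ler_wpM2r ?powR_ge0 ?ler_norm.
Qed.

Section ExtendedNorms.
Variable R : realType.
Implicit Types (X : set (\bar R)) (e c : \bar R).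

Lemma esup0_ge0 X : (0 <= esup0 X)%E.
Proof. by apply: ereal_sup_ubound; left. Qed.

Lemma esup0_ub X e : X e -> (e <= esup0 X)%E.
Proof. by move=> Xe; apply: ereal_sup_ubound; right. Qed.

Lemma esup0_le X c : (0 <= c)%E -> (forall e, X e -> (e <= c)%E) ->
  (esup0 X <= c)%E.
Proof. by move=> c0 h; apply: ge_ereal_sup => e [->|/h]. Qed.

Variables (S : regularity_structure R) (d : nat) (s : scaling d) (M : model S s).
Variables (gamma : R) (K : set 'rV[R]_d).
Implicit Types f : 'rV[R]_d -> rs_type S.

Lemma md_norm0_ge0 f : (0 <= md_norm0 gamma K f)%E. Proof. exact: esup0_ge0. Qed.

Lemma md_norm_ge0 f : (0 <= md_norm M gamma K f)%E.
Proof. by apply: adde_ge0; exact: esup0_ge0. Qed.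

(** Components of degree outside the index set are zero, so the bound extends to all [a < gamma],
    the form in which [of_order] states it. *)
Lemma md_norm0P f (N : R) : 0 <= N ->
  (md_norm0 gamma K f <= N%:E)%E <->
  (forall x a, K x -> a < gamma -> `|f x a| <= N).
Proof.
move=> N0; split => [h x a Kx ag|h].
  have [Sa|Sa] := pselect (rs_index S a); last first.
    by rewrite (rs_space_trivial Sa (f x a)) normr0.
  rewrite -lee_fin; apply: le_trans h; apply: esup0_ub.
  by exists x, a.
apply: esup0_le => [|e [x [a [Kx Sa ag ->]]]]; first by rewrite lee_fin.
by rewrite lee_fin; apply: h.
Qed.

(** Restricting to [x != y] makes the scaled distance positive, as [scale01] requires. On the
    diagonal the numerator is zero, since Gamma_xx is the identity. *)
Lemma md_seminormP f (N : R) : 0 <= N ->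
  (md_seminorm M gamma K f <= N%:E)%E <->
  (forall x y a, K x -> K y -> x != y -> sc_norm s (x - y) <= 1 -> a < gamma ->
     `|(f x - mod_Gamma M x y (f y)) a| <= N * sc_norm s (x - y) `^ (gamma - a)).
Proof.
move=> N0; split => [h x y a Kx Ky xy xy1 ag|h].
  have d0 : 0 < sc_norm s (x - y) by rewrite sc_norm_gt0// subr_eq0.
  have [Sa|Sa] := pselect (rs_index S a); last first.
    by rewrite (rs_space_trivial Sa (_ a)) normr0 mulr_ge0 ?powR_ge0.
  rewrite -ler_pdivrMr ?powR_gt0// -lee_fin; apply: le_trans h; apply: esup0_ub.
  by exists x, y, a.
apply: esup0_le => [|e [x [y [a [Kx Ky xy1 [Sa ag] ->]]]]]; first by rewrite lee_fin.
rewrite lee_fin; have [->|xy] := eqVneq x y.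
  by rewrite mod_Gamma_id subrr normr0 mul0r.
rewrite ler_pdivrMr ?h// powR_gt0// sc_norm_gt0// subr_eq0//.
Qed.

Lemma md_norm_le f (N : R) : (md_norm M gamma K f <= N%:E)%E ->
  (md_norm0 gamma K f <= N%:E)%E /\ (md_seminorm M gamma K f <= N%:E)%E.
Proof.
by move=> h; split; apply: le_trans h; rewrite /md_norm ?leeDl ?leeDr//;
  exact: esup0_ge0.
Qed.

Lemma le_sum_term n (a : 'I_n -> \bar R) i : (forall j, (0 <= a j)%E) ->
  (a i <= \sum_(j < n) a j)%E.
Proof. by move=> a0; rewrite (bigD1 i)//= leeDl// sume_ge0. Qed.

End ExtendedNorms.

Section LiftBounds.
Variables (R : realType) (S : regularity_structure R) (star : product S).
Variables (d : nat) (s : scaling d) (M : model S s).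
Variables (V : function_like_sector S) (gamma z : R).
Hypothesis V_star : product_invariant V star.
Hypothesis gamma_gt0 : 0 < gamma.
Hypothesis V_regular : regular_sector V star gamma.
Hypothesis z_gt0 : 0 < z.
Hypothesis z_le : z <= gamma.
Hypothesis V_gap : forall x : rs_type S,
  sector_set V x -> forall a, 0 < a -> a < z -> x a = 0.
Variables (n : nat) (F : 'rV[R]_n -> R) (m : nat) (theta : R).
Hypothesis theta_gt0 : 0 < theta.
Hypothesis theta_le1 : theta <= 1.
Hypothesis gamma_le : gamma <= z * (m%:R + theta).
Variables (K : set 'rV[R]_d).
Hypothesis K_compact : compact K.

Variables (I : Type) (f : I -> bool -> 'I_n -> 'rV[R]_d -> rs_type S).
Variables (eps : I -> R) (B : R).
Hypothesis eps_ge0 : forall j, 0 <= eps j.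
Hypothesis B_ge0 : 0 <= B.
Hypothesis f_sector : forall j b i x, dlt gamma (f j b i x) /\ sector_set V (f j b i x).
Hypothesis F_regular : holder_class m theta F /\ diagonal_family f \/ holder_class m.+1 theta F.

Let point_regular (J : Type) (j : J -> I) (x : J -> 'rV[R]_d) :
  lift_regular F m theta (fun p b i => f (j p) b i (x p)).
Proof. by case: F_regular => [[hF df]|hF]; [left; split => // p; rewrite df|right]. Qed.

Let point_static (J : Type) (j : J -> I) (x : J -> 'rV[R]_d) i :
  (forall p, K (x p)) ->
  (forall j b i, (md_norm0 gamma K (f j b i) <= B%:E)%E) ->
  (forall j i, (md_norm0 gamma K (fun x => (f j true i x - f j false i x)%R) <= (eps j)%:E)%E) ->
  of_order V gamma (eps \o j) (fun=> 1) 0 (fun p b => f (j p) b i (x p)).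
Proof.
move=> Kx hB he; split => [p b|]; first exact: (f_sector _ _ _ _).2.
exists (B + 1) => [|p a ag]; first exact: addr_ge0.
rewrite powR1 mulr1; split => /=.
- by rewrite (le_trans (proj1 (md_norm0P _ _ _ B_ge0) (hB _ _ _) _ _ (Kx p) ag))// lerDl.
- by rewrite (le_trans (proj1 (md_norm0P _ _ _ B_ge0) (hB _ _ _) _ _ (Kx p) ag))// lerDl.
have := proj1 (md_norm0P _ _ _ (eps_ge0 _)) (he (j p) i) _ _ (Kx p) ag.
by move=> /le_trans; apply; rewrite mulrDl mul1r lerDr mulr_ge0.
Qed.

Lemma lift_norm0_bound :
  (forall j b i, (md_norm0 gamma K (f j b i) <= B%:E)%E) ->
  (forall j i, (md_norm0 gamma K (fun x => (f j true i x - f j false i x)%R) <= (eps j)%:E)%E) ->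
  exists2 L, 0 <= L & forall j,
    (forall b, (md_norm0 gamma K (Fhat star F gamma (f j b)) <= L%:E)%E) /\
    (md_norm0 gamma K (fun x => (Fhat star F gamma (f j true) x
       - Fhat star F gamma (f j false) x)%R) <= (L * eps j)%:E)%E.
Proof.
move=> hB he.
(* All pairs of distributions and all points of [K] form a single family, so the constant produced
   by [lift_static] is uniform in both. *)
pose J := {p : I * 'rV[R]_d | K p.2}.
pose ix (p : J) := (sval p).1; pose pt (p : J) := (sval p).2.
have Kpt p : K (pt p) by exact: (svalP p).
have [_ [L L0 HL]] := lift_static V_star gamma_gt0 z_gt0 V_gap theta_le1 gamma_le
  (fun p => eps_ge0 (ix p)) (@point_regular _ ix pt)
  (fun i => @point_static _ ix pt i Kpt hB he).
exists L => // j; split => [b|].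
  apply/md_norm0P => // x a Kx ag.
  have := HL (exist _ (j, x) Kx) a ag; rewrite powR1 mulr1 => -[h1 h2 _].
  by case: b.
apply/md_norm0P => [|x a Kx ag]; first exact: mulr_ge0.
by have := HL (exist _ (j, x) Kx) a ag; rewrite powR1 mulr1 => -[].
Qed.

Lemma lift_seminorm_bound :
  (forall j b i, (md_norm M gamma K (f j b i) <= B%:E)%E) ->
  (forall j i, (md_norm M gamma K (fun x => (f j true i x - f j false i x)%R) <= (eps j)%:E)%E) ->
  exists2 L, 0 <= L & forall j,
    (forall b, (md_seminorm M gamma K (Fhat star F gamma (f j b)) <= L%:E)%E) /\
    (md_seminorm M gamma K (fun x => (Fhat star F gamma (f j true) x
       - Fhat star F gamma (f j false) x)%R) <= (L * eps j)%:E)%E.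
Proof.
move=> hB he.
(* As before, but with pairs of distinct points of [K] at distance at most 1; [delta] is their
   scaled distance. *)
pose P (p : I * ('rV[R]_d * 'rV[R]_d)) :=
  [/\ K p.2.1, K p.2.2, p.2.1 != p.2.2 & sc_norm s (p.2.1 - p.2.2) <= 1].
pose J := {p | P p}.
pose ix (p : J) := (sval p).1.
pose x (p : J) := (sval p).2.1; pose y (p : J) := (sval p).2.2.
have Kx p : K (x p) by have [] := svalP p.
have Ky p : K (y p) by have [] := svalP p.
pose delta p := sc_norm s (x p - y p).
have d01 : scale01 delta.
  by move=> p; have [_ _ xy ->] := svalP p; rewrite sc_norm_gt0 ?subr_eq0.
pose Gam p := mod_Gamma M (x p) (y p).
have [C C0 HC] := Gamma_bound M gamma_gt0 K_compact.
have Gam_bound : exists2 C : R, 0 <= C & forall p a (u : rs_space S a) k,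
    rs_index S a -> a < gamma -> k < a ->
    `|Gam p (dinj u) k| <= C * `|u| * delta p `^ (a - k).
  by exists C => // p a u k; apply: HC.
have hB0 j b i := (md_norm_le (hB j b i)).1.
have he0 j i := (md_norm_le (he j i)).1.
have fxy i : of_order V gamma (eps \o ix) delta gamma
    (fun p b => f (ix p) b i (x p) - Gam p (f (ix p) b i (y p))).
  split => [p b|].
    apply: sectorB; first exact: (f_sector _ _ _ _).2.
    by apply: sec_group; [exact: mod_Gamma_group|exact: (f_sector _ _ _ _).2].
  exists (B + 1) => [|p a ag]; first exact: addr_ge0.
  have [_ _ xy xy1] := svalP p.
  have D0 : 0 <= delta p `^ (gamma - a) by exact: powR_ge0.
  have hb b : `|(f (ix p) b i (x p) - Gam p (f (ix p) b i (y p))) a|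
      <= (B + 1) * delta p `^ (gamma - a).
    apply: (le_trans (proj1 (md_seminormP _ _ _ _ B_ge0) (md_norm_le (hB _ b i)).2
      (x p) (y p) a (Kx p) (Ky p) xy xy1 ag)).
    by rewrite ler_wpM2r// lerDl.
  split => //.
  have := proj1 (md_seminormP _ _ _ _ (eps_ge0 _)) (md_norm_le (he (ix p) i)).2
      (x p) (y p) a (Kx p) (Ky p) xy xy1 ag.
  have -> : f (ix p) true i (x p) - f (ix p) false i (x p) -
      mod_Gamma M (x p) (y p) (f (ix p) true i (y p) - f (ix p) false i (y p))
    = f (ix p) true i (x p) - Gam p (f (ix p) true i (y p)) -
      (f (ix p) false i (x p) - Gam p (f (ix p) false i (y p))).
    by rewrite linearB /= !opprD !opprK addrACA.
  move=> /le_trans; apply; rewrite mulrAC ler_wpM2r//.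
  by rewrite /= mulrDl mul1r lerDr mulr_ge0.
have [_ [L L0 HL]] := lift_order V_star gamma_gt0 V_regular z_gt0 z_le V_gap
  theta_gt0 theta_le1 gamma_le (fun p => eps_ge0 (ix p)) d01
  (fun p => mod_Gamma_group M (x p) (y p)) Gam_bound
  (@point_regular _ ix x) (@point_regular _ ix y)
  (fun i => @point_static _ ix x i Kx hB0 he0) (fun i => @point_static _ ix y i Ky hB0 he0)
  (fun p b i => (f_sector (ix p) b i (y p)).1) fxy.
exists L => // j; split => [b|].
  apply/md_seminormP => // x' y' a Kx' Ky' xy xy1 ag.
  have Pxy : P (j, (x', y')) by [].
  by have [h1 h2 _] := HL (exist _ _ Pxy) a ag; case: b.
apply/md_seminormP => [|x' y' a Kx' Ky' xy xy1 ag]; first exact: mulr_ge0.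
have Pxy : P (j, (x', y')) by [].
have [_ _ +] := HL (exist _ _ Pxy) a ag.
have -> : Fhat star F gamma (f j true) x' - Fhat star F gamma (f j false) x' -
      mod_Gamma M x' y' (Fhat star F gamma (f j true) y' - Fhat star F gamma (f j false) y')
    = Fhat star F gamma (f j true) x' - mod_Gamma M x' y' (Fhat star F gamma (f j true) y') -
      (Fhat star F gamma (f j false) x' - mod_Gamma M x' y' (Fhat star F gamma (f j false) y')).
  by rewrite linearB /= !opprD !opprK addrACA.
by rewrite [in X in _ -> X]dcompB [X in _ -> _ <= X]mulrAC.
Qed.

End LiftBounds.

Section Differences.
Variables (R : realType) (S : regularity_structure R) (d : nat) (s : scaling d).
Variables (M : model S s) (gamma : R) (K : set 'rV[R]_d).
Implicit Types f : 'rV[R]_d -> rs_type S.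

Lemma md_norm_sub_self f : (md_norm M gamma K (fun x => (f x - f x)%R) <= 0)%E.
Proof.
rewrite -[leRHS]adde0; apply: leeD.
  by apply/md_norm0P => // x a _ _; rewrite subrr normr0.
apply/md_seminormP => // x y a _ _ _ _ _.
by rewrite !subrr linear0 subrr normr0 mul0r.
Qed.

Lemma vec_term_le n (a b : 'I_n -> \bar R) (C : R) i :
  (forall j, (0 <= a j)%E) -> (forall j, (0 <= b j)%E) ->
  (\sum_(j < n) a j + \sum_(j < n) b j <= C%:E)%E ->
  (a i <= `|C|%:E)%E /\ (b i <= `|C|%:E)%E.
Proof.
move=> a0 b0 h.
have hC : (C%:E <= `|C|%:E)%E by rewrite lee_fin ler_norm.
split; apply: le_trans hC; apply: le_trans h.
  by rewrite (le_trans (le_sum_term _ a0))// leeDl// sume_ge0.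
by rewrite (le_trans (le_sum_term i b0))// leeDr// sume_ge0.
Qed.

(* [L + 1] rather than [L], so that the right-hand side is infinite when [e] is. *)
Lemma le_mul_ereal (x e : \bar R) (L : R) : 0 <= L -> (0 <= e)%E ->
  (forall r : R, e = r%:E -> (x <= (L * r)%:E)%E) -> (x <= (L + 1)%:E * e)%E.
Proof.
move=> L0; case: e => [r| |] // r0 h.
  by rewrite -EFinM (le_trans (h r erefl))// lee_fin ler_wpM2r// lerDl//.
by rewrite gt0_muley ?leey// lte_fin ltr_wpDl.
Qed.

End Differences.

Theorem theorem4p16 (R : realType) (S : regularity_structure R)
    (star : product S) (d : nat) (s : scaling d) (M : model S s)
    (V : function_like_sector S) (n : nat) (F : 'rV[R]_n -> R)
    (gamma kappa : R)
    (V_star : product_invariant V star)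
    (gamma_gt0 : 0 < gamma)
    (kappa_ge : Num.max (zeta_ratio V gamma) 1 <= kappa)
    (F_holder : holder_space kappa F)
    (V_regular : regular_sector V star gamma) :
  (forall f : 'I_n -> 'rV[R]_d -> rs_type S,
     (forall i, modelled M V gamma (f i)) ->
     modelled M V gamma (Fhat star F gamma f)) /\
  (forall kappa' : R,
     Num.max (zeta_ratio V gamma) 1 + 1 <= kappa' ->
     holder_space kappa' F ->
     forall K : set 'rV[R]_d, compact K -> forall C : R,
       (exists L : R, forall f g : 'I_n -> 'rV[R]_d -> rs_type S,
          (forall i, modelled M V gamma (f i)) ->
          (forall i, modelled M V gamma (g i)) ->
          (md_norm0_vec gamma K f + md_norm0_vec gamma K g <= C%:E)%E ->
          (md_norm0 gamma K
             (fun x => (Fhat star F gamma f x - Fhat star F gamma g x)%R)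
           <= L%:E * md_norm0_vec gamma K (fun i x => (f i x - g i x)%R))%E) /\
       (exists L : R, forall f g : 'I_n -> 'rV[R]_d -> rs_type S,
          (forall i, modelled M V gamma (f i)) ->
          (forall i, modelled M V gamma (g i)) ->
          (md_norm_vec M gamma K f + md_norm_vec M gamma K g <= C%:E)%E ->
          (md_norm M gamma K
             (fun x => (Fhat star F gamma f x - Fhat star F gamma g x)%R)
           <= L%:E * md_norm_vec M gamma K (fun i x => (f i x - g i x)%R))%E)).
Proof.
have [z [z0 zg gz gap]] := sector_gap V gamma_gt0.
have [m [t [t0 t1 kE hF]]] := holder_class_space F_holder.
have gm : gamma <= z * (m%:R + t).
  by apply: (le_trans gz); rewrite ler_wpM2l ?(ltW z0)// -kE.
have gm1 : gamma <= z * m.+1%:R.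
  by apply: (le_trans gm); rewrite ler_wpM2l ?(ltW z0)// -natr1 lerD2l.
split => [f hf|kappa' k'ge F_holder' K cK C].
  have Vf i x : dlt gamma (f i x) /\ sector_set V (f i x) by exact: (hf i).1.
  split => [x|K cK].
    by apply: (Fhat_trunc_sector V_star z0 gap F _ gm1) => i; exact: (Vf i x).2.
  pose B := \sum_i fine (md_norm M gamma K (f i)).
  have nE i : (fine (md_norm M gamma K (f i)))%:E = md_norm M gamma K (f i).
    by rewrite fineK// ge0_fin_numE ?(hf i).2//; exact: md_norm_ge0.
  have f0 i : 0 <= fine (md_norm M gamma K (f i)).
    by rewrite -lee_fin nE; exact: md_norm_ge0.
  have B0 : 0 <= B by exact: sumr_ge0.
  (* For a single [f], both members of the pair are [f] and [eps] is 0; this is the diagonal case,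
     which uses only the given regularity of F. *)
  pose ff (_ : unit) (_ : bool) := f.
  have hB (j : unit) (b : bool) i : (md_norm M gamma K (ff j b i) <= B%:E)%E.
    by rewrite /ff -nE lee_fin /B (bigD1 i)//= lerDl sumr_ge0.
  have he (j : unit) i : (md_norm M gamma K
      (fun x => (ff j true i x - ff j false i x)%R) <= 0%:E)%E.
    exact: md_norm_sub_self.
  have reg : holder_class m t F /\ diagonal_family ff \/ holder_class m.+1 t F.
    by left; split.
  have e0 (j : unit) : 0 <= (0 : R) by [].
  have [L0 _ H0] := lift_norm0_bound V_star gamma_gt0 z0 gap t1 gm e0 B0
    (fun _ _ => Vf) reg (fun j b i => (md_norm_le (hB j b i)).1)
    (fun j i => (md_norm_le (he j i)).1).
  have [L1 _ H1] := lift_seminorm_bound V_star gamma_gt0 V_regular z0 zg gap t0 t1 gm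
    cK e0 B0 (fun _ _ => Vf) reg hB he.
  apply: (@le_lt_trans _ _ (L0%:E + L1%:E)%E); last by rewrite -EFinD ltry.
  apply: leeD; [exact: (H0 tt).1 true|exact: (H1 tt).1 true].
have [m' [t' [t'0 t'1 k'E hF']]] := holder_class_space F_holder'.
have max1 : 1 <= Num.max (zeta_ratio V gamma) 1 by rewrite le_max lexx orbT.
(* Here kappa' >= 2, while m' = 0 would give kappa' = t' <= 1. So m' is a successor, and its
   predecessor serves as the order of expansion. *)
case: m' k'E hF' => [|m'] k'E hF'.
  by exfalso; move: k'ge max1; rewrite k'E add0r; lra.
have gm' : gamma <= z * (m'%:R + t').
  apply: (le_trans gz); rewrite ler_wpM2l ?(ltW z0)//.
  by move: k'ge; rewrite k'E -natr1 addrAC lerD2r.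
pose T := 'I_n -> 'rV[R]_d -> rs_type S.
split.
(* The family ranges over all admissible pairs (f, g). The distance of f and g is part of the index
   as a real number, since [eps] is real-valued; an infinite distance is dealt with by
   [le_mul_ereal]. *)
- pose P (p : (T * T) * R) := [/\ forall i, modelled M V gamma (p.1.1 i),
    forall i, modelled M V gamma (p.1.2 i),
    (md_norm0_vec gamma K p.1.1 + md_norm0_vec gamma K p.1.2 <= C%:E)%E &
    md_norm0_vec gamma K (fun i x => (p.1.1 i x - p.1.2 i x)%R) = p.2%:E].
  pose ff (p : {p | P p}) (b : bool) := if b then (sval p).1.1 else (sval p).1.2.
  have v0 (h : T) : (0 <= md_norm0_vec gamma K h)%E.
    by apply: sume_ge0 => i _; exact: md_norm0_ge0.
  have e0 (p : {p | P p}) : 0 <= (sval p).2.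
    by rewrite -lee_fin; have [_ _ _ <-] := svalP p.
  have Vf (p : {p | P p}) b i x : dlt gamma (ff p b i x) /\ sector_set V (ff p b i x).
    by have [h1 h2 _ _] := svalP p; case: b; [exact: (h1 i).1|exact: (h2 i).1].
  have hB (p : {p | P p}) b i : (md_norm0 gamma K (ff p b i) <= `|C|%:E)%E.
    have [_ _ hC _] := svalP p.
    have := vec_term_le i (fun i => md_norm0_ge0 _ _ _) (fun i => md_norm0_ge0 _ _ _) hC.
    by case: b => -[].
  have he (p : {p | P p}) i : (md_norm0 gamma K
      (fun x => (ff p true i x - ff p false i x)%R) <= (sval p).2%:E)%E.
    have [_ _ _ <-] := svalP p.
    exact: (le_sum_term i (fun i => md_norm0_ge0 _ _ _)).
  have [L L0 H] := lift_norm0_bound V_star gamma_gt0 z0 gap t'1 gm' e0 (normr_ge0 C)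
    Vf (or_intror hF') hB he.
  exists (L + 1) => f g hf hg hfg; apply: le_mul_ereal => // r rE.
  have Pfg : P ((f, g), r) by [].
  exact: (H (exist _ _ Pfg)).2.
- pose P (p : (T * T) * R) := [/\ forall i, modelled M V gamma (p.1.1 i),
    forall i, modelled M V gamma (p.1.2 i),
    (md_norm_vec M gamma K p.1.1 + md_norm_vec M gamma K p.1.2 <= C%:E)%E &
    md_norm_vec M gamma K (fun i x => (p.1.1 i x - p.1.2 i x)%R) = p.2%:E].
  pose ff (p : {p | P p}) (b : bool) := if b then (sval p).1.1 else (sval p).1.2.
  have v0 (h : T) : (0 <= md_norm_vec M gamma K h)%E.
    by apply: sume_ge0 => i _; exact: md_norm_ge0.
  have e0 (p : {p | P p}) : 0 <= (sval p).2.
    by rewrite -lee_fin; have [_ _ _ <-] := svalP p.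
  have Vf (p : {p | P p}) b i x : dlt gamma (ff p b i x) /\ sector_set V (ff p b i x).
    by have [h1 h2 _ _] := svalP p; case: b; [exact: (h1 i).1|exact: (h2 i).1].
  have hB (p : {p | P p}) b i : (md_norm M gamma K (ff p b i) <= `|C|%:E)%E.
    have [_ _ hC _] := svalP p.
    have := vec_term_le i (fun i => md_norm_ge0 _ _ _ _) (fun i => md_norm_ge0 _ _ _ _) hC.
    by case: b => -[].
  have he (p : {p | P p}) i : (md_norm M gamma K
      (fun x => (ff p true i x - ff p false i x)%R) <= (sval p).2%:E)%E.
    have [_ _ _ <-] := svalP p.
    exact: (le_sum_term i (fun i => md_norm_ge0 _ _ _ _)).
  have [L0 L00 H0] := lift_norm0_bound V_star gamma_gt0 z0 gap t'1 gm' e0 (normr_ge0 C)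
    Vf (or_intror hF') (fun j b i => (md_norm_le (hB j b i)).1)
    (fun j i => (md_norm_le (he j i)).1).
  have [L1 L10 H1] := lift_seminorm_bound V_star gamma_gt0 V_regular z0 zg gap t'0 t'1 gm'
    cK e0 (normr_ge0 C) Vf (or_intror hF') hB he.
  (* [L0] and [L1] bound the two parts of the norm, and the 1 is the one in [le_mul_ereal]. *)
  exists (L0 + L1 + 1) => f g hf hg hfg; apply: le_mul_ereal => // [|r rE].
    exact: addr_ge0.
  have Pfg : P ((f, g), r) by [].
  rewrite mulrDl EFinD; apply: leeD.
    exact: (H0 (exist _ _ Pfg)).2.
  exact: (H1 (exist _ _ Pfg)).2.
Qed.
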